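(* There exist absolute constants $x_0$ and $c>0$ such that the following holds for all $x\ge x_0$. Let $(a(n))$, $\mathcal A$, $\mathcal S$, $h$, $f_q$, $\gamma_q$ be as in the context, and suppose that $\mathcal S\subset[1,\log\log x]$ and that $0\le h(n)\le1$ for all $n$. Suppose that $$\sum_{p\le\log x}\frac{1-h(p)}{p}\log p\ \ge\ \alpha\log\log x$$ for some $\alpha\ge 60\log\log\log x/\log\log x$, and set $\eta=\min(\alpha/3,1/100)$. Then for each real $u$ with $5/\eta^2\le u\le\eta(\log x)^{\eta/2}$ at least one of the following two assertions holds: (i) There exists an interval $(v,v+y)\subset(x/4,x)$ with $y\ge(\log x)^u$ such that $$\Big|\mathcal A(v+y)-\mathcal A(v)-y\frac{\mathcal A(x)}{x}\Big|\ \ge\ c\,\exp\Big(-\frac u\eta(1+25\eta)\log(2u/\eta^3)\Big)\,y\,\frac{\mathcal A(x)}{x}.$$ (ii) There exist $y\in(x/4,x)$ and an arithmetic progression $a\pmod q$ with $(q,\mathcal S)=1$ and $q\le\exp(2(\log x)^{1-\eta})$ such that $$\Big|\mathcal A(y;q,a)-\frac{f_q(a)}{q\gamma_q}\,y\,\frac{\mathcal A(x)}{x}\Big|\ \ge\ c\,\exp\Big(-\frac u\eta(1+25\eta)\log(2u/\eta^3)\Big)\frac{\mathcal A(x)}{\phi(q)}.$$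
   Context: $(a(n))_{n\ge1}$ is a sequence of non-negative real numbers, $\mathcal A(x)=\sum_{n\le x}a(n)$ and $\mathcal A(x;q,a)=\sum_{n\le x,\ n\equiv a\,(\mathrm{mod}\ q)}a(n)$. $\mathcal S$ is a finite set of primes, and $(q,\mathcal S)=1$ means that no prime of $\mathcal S$ divides $q$. $h$ is a non-negative real-valued multiplicative function. For a positive integer $q$ put $$\gamma_q=\prod_{p\mid q}\Big(\frac{1-h(p)/p}{1-1/p}\Big)^{-1}.$$ $f_q$ is the multiplicative function defined as follows: $f_q(p^k)=1$ if $p\nmid q$; if $p^e$ (with $e\ge1$) is the exact power of $p$ dividing $q$, then $$f_q(p^k)=\Big(h(p^k)-\frac{h(p^{k+1})}{p}\Big)\Big(1-\frac{h(p)}p\Big)^{-1}\ \text{ if }k<e,\qquad f_q(p^k)=h(p^e)\Big(1-\frac1p\Big)\Big(1-\frac{h(p)}p\Big)^{-1}\ \text{ if }k\ge e.$$ Thus $f_q(a)=f_q((a,q))$, and this extends $f_q$ to all integers $a$ (with $f_q(0)=f_q(q)$). Sums and products over $p$ run over primes; $\phi$ is Euler's totient function. *)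

(* Defs.v *)
From mathcomp Require Import all_boot all_order all_algebra finmap.
From mathcomp Require Import all_classical all_reals all_analysis.

Set Implicit Arguments.
Unset Strict Implicit.
Unset Printing Implicit Defensive.
Import Order.TTheory GRing.Theory Num.Theory.
Local Open Scope ring_scope.

(* Sequences and arithmetic functions on the positive integers are functions
   on [nat] whose value at 0 is never used.  [Num.truncn x] is the integer
   part of [x] when [0 <= x], and 0 otherwise. *)

Definition summatory (R : realType) (a : nat -> R) (x : R) : R :=
  \sum_(1 <= n < (Num.truncn x).+1) a n.

Definition summatory_ap (R : realType) (a : nat -> R) (x : R)
    (q : nat) (b : int) : R :=
  \sum_(1 <= n < (Num.truncn x).+1 | (n%:Z == b %[mod q%:Z])%Z) a n.

Definition multiplicative_fun (R : realType) (h : nat -> R) : Prop :=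
  h 1%N = 1 /\
  forall m n : nat, (0 < m)%N -> (0 < n)%N -> coprime m n ->
    h (m * n)%N = h m * h n.

Definition coprime_to_all (q : nat) (S : {fset nat}) : Prop :=
  forall p : nat, p \in S -> ~~ (p %| q)%N.

Definition gamma_q (R : realType) (h : nat -> R) (q : nat) : R :=
  \prod_(p <- primes q) ((1 - h p / p%:R) / (1 - 1 / p%:R))^-1.

Definition f_q_primepow (R : realType) (h : nat -> R) (q p k : nat) : R :=
  let e := logn p q in
  if ~~ (p %| q)%N then 1
  else if (k < e)%N
  then (h (p ^ k)%N - h (p ^ k.+1)%N / p%:R) * (1 - h p / p%:R)^-1
  else h (p ^ e)%N * (1 - 1 / p%:R) * (1 - h p / p%:R)^-1.

Definition f_q (R : realType) (h : nat -> R) (q n : nat) : R :=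
  \prod_(p <- primes n) f_q_primepow h q p (logn p n).

(* Extension of f_q to all integers through f_q(b) = f_q((b, q)); since
   [gcdn 0 q = q], this gives f_q(0) = f_q(q). *)
Definition f_qz (R : realType) (h : nat -> R) (q : nat) (b : int) : R :=
  f_q h q (gcdn `|b|%N q).

(* Main.v *)
Require Import Defs.
From mathcomp Require Import all_boot all_order all_algebra finmap.
From mathcomp Require Import all_classical all_reals all_analysis.
From mathcomp Require Import complex ring lra zify.

Set Implicit Arguments.
Unset Strict Implicit.
Unset Printing Implicit Defensive.
Import Order.TTheory GRing.Theory Num.Theory.
Import numFieldNormedType.Exports.
Import Normc.
Local Open Scope classical_set_scope.
Local Open Scope ring_scope.

(** The idea of the proof.  Write l = ln x, L = ln l and rho = A(x)/x.

    Arrange the numbers a(r q + s), with x/4 < r q < x/2 and 1 <= s <= n, in a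
    matrix whose rows are intervals of length n and whose columns are
    arithmetic progressions modulo q.  If both assertions fail, every row sum
    is close to n rho, and every column sum is close to the one predicted by
    f_q.  Comparing the two evaluations of the total, the sum of f_q(s) over
    s <= n is gamma_q n with an error of at most 33 delta n, for every n
    between l^u and x/4, provided that q/phi(q) <= 2 ([maier_matrix]).  It therefore
    suffices to exhibit one modulus q and one n for which the sieve error
    E(n) = sum_(s <= n) f_q(s) - gamma_q n is larger ([sieve_error_large]).

    The modulus is the product of the primes in a window P < p <= P^(21/20)
    with l^(9 eta/5) <= P and P^(21/20) <= l^(1 - eta), on which the sum of
    (1 - h(p))/p is at least eta/250.  Such a window exists: by Mertens'
    estimate the primes outside [l^(19 eta/10), l^(1 - eta)] contribute at most
    (29/10) eta L + O(1) to the sum in the hypothesis, which is at least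
    3 eta L, and the remaining range is covered by windows whose logarithms
    form a geometric progression ([exists_dense_window]).  For this squarefree
    q, f_q(n) is the product of 1 - g_p over the primes p dividing (n, q),
    where 1 - h(p) <= g_p <= 1.

    The sieve error cannot be small everywhere because of its Dirichlet
    series.  The series of f_q is zeta(s) G(s) with G(s) the product of
    1 - g_p p^(-s), and summation by parts bounds |zeta(s)| |G(s) - gamma_q| by
    |s| times the sum of |E(n)| n^(-Re s - 1) ([abel_bound]).  At
    s = 1 - sigma - i t with t = pi / ((41/40) ln P), p^(i t) is close to -1 on
    the whole window, so that |G(s)| >= exp((99/100) Lam), where
    Lam = sum_p g_p p^(sigma - 1) ([sieve_euler_product_ge]).  On the other
    hand |E(n)| <= n^(1 - sigma') prod_p (1 + g_p p^(sigma' - 1)) for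
    0 <= sigma' <= 1 ([sieve_error_bound]).  With sigma' slightly below sigma
    this makes the part n <= P^(4 Lam/5) of the sum small compared with
    |G(s)|, and with sigma' slightly above sigma the part n > P^(7 Lam/5): both
    are large deviations of a Poisson variable of mean Lam.  Hence |E(n)|/n is
    at least about P^(-7 sigma Lam/5) for some n in between
    ([sieve_error_not_small]).

    Finally sigma is chosen such that P^(4 Lam/5) = l^u ([exists_tilt]).  Then
    P^sigma <= Lam / (sum_p g_p/p) <= 2u/eta^3 and (7/5) Lam <= u/eta, which is
    the claimed order of magnitude. *)

(** * Elementary inequalities *)

Section Elementary.
Variable R : realType.
Implicit Types x y : R.

Lemma powRE x y : 0 < x -> x `^ y = expR (y * ln x).
Proof. by move=> x0; rewrite /powR gt_eqF. Qed.

Lemma sin_le x : 0 <= x -> `|sin x| <= x.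
Proof.
move=> x0.
have [|c _ hc] := @MVT_segment R sin cos 0 x x0 (fun y _ => is_derive_sin y).
  by apply: derivable_within_continuous => y _; exact: derivable_sin.
rewrite sin0 !subr0 in hc; rewrite hc normrM (ger0_norm x0).
by rewrite ler_piMl// cos_max.
Qed.

Lemma cos_lower x : 1 - x ^+ 2 / 2 <= cos x.
Proof.
wlog x0 : x / 0 <= x.
  move=> h; have [x0|x0] := leP 0 x; first exact: h.
  by rewrite -cosN -sqrrN; apply: h; rewrite oppr_ge0 ltW.
have x20 : 0 <= x / 2 by rewrite divr_ge0.
have := sin_le x20; rewrite -(ler_pXn2r (isT : (0 < 2)%N)) ?nnegrE// real_normK ?num_real// => h.
have -> : cos x = cos ((x / 2) *+ 2) by rewrite mulr2n -splitr.
rewrite cos_mulr2n cos2sin2.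
have e : (x / 2) ^+ 2 = x ^+ 2 / 4 by field.
by rewrite e in h; lra.
Qed.

(** Compare with the inverse: exp(-(x - x^2)) >= 1 - x + x^2, and
    (1 + x)(1 - x + x^2) = 1 + x^3 >= 1. *)
Lemma expR_subr_sqr_le x : 0 <= x <= 1 -> expR (x - x ^+ 2) <= 1 + x.
Proof.
move=> /andP[x0 x1].
have h := expR_ge1Dx (- (x - x ^+ 2)).
have x1' : 0 < 1 + x by lra.
have e := expR_gt0 (x - x ^+ 2).
rewrite expRN in h.
have := ler_wpM2l (ltW e) h; rewrite mulfV ?gt_eqF// => h2.
have h3 : 1 <= (1 + x) * (1 - (x - x ^+ 2)).
  have -> : (1 + x) * (1 - (x - x ^+ 2)) = 1 + x ^+ 3 by ring.
  by rewrite lerDl exprn_ge0.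
have h4 : 0 < 1 - (x - x ^+ 2) by nra.
by rewrite -(ler_pM2r h4); apply: le_trans h3; exact: h2.
Qed.

Lemma prod_1D_le_expR (I : eqType) (s : seq I) (F : I -> R) :
  (forall i, i \in s -> 0 <= F i) ->
  \prod_(i <- s) (1 + F i) <= expR (\sum_(i <- s) F i).
Proof.
move=> hF; rewrite expR_sum big_seq [leRHS]big_seq.
by apply: ler_prod => i si; rewrite addr_ge0 ?hF//= expR_ge1Dx.
Qed.

(** Convexity of exp, obtained from its tangent at z = th ln x. *)
Lemma powR_bernoulli x th : 0 < x -> 0 <= th -> th <= 1 ->
  x `^ th <= 1 + th * (x - 1).
Proof.
move=> x0 th0 th1; rewrite powRE//.
set z := th * ln x.
have h1 := expR_ge1Dx (ln x - z); have h2 := expR_ge1Dx (- z).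
have e1 : x = expR z * expR (ln x - z) by rewrite -expRD addrC subrK lnK// posrE.
have e2 : 1 = expR z * expR (- z) by rewrite -expRD subrr expR0.
have z0 := expR_ge0 z.
have g1 := ler_wpM2l z0 h1; have g2 := ler_wpM2l z0 h2.
rewrite -e1 in g1; rewrite -e2 in g2.
have g3 := ler_wpM2l th0 g1.
have th1' : 0 <= 1 - th by rewrite subr_ge0.
have g4 := ler_wpM2l th1' g2.
have : expR z * (th * (1 + (ln x - z)) + (1 - th) * (1 - z)) = expR z.
  by rewrite /z; ring.
move: g3 g4; lra.
Qed.

(** Comparison with the integral of v^(th - 1), in telescoping form. *)
Lemma sum_powR_le (th : R) N : 0 < th <= 1 ->
  \sum_(1 <= n < N.+1) (n%:R : R) `^ (th - 1) <= N%:R `^ th / th.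
Proof.
move=> /andP[th0 th1]; elim: N => [|N IH].
  by rewrite big_geq// powR0 ?mul0r// gt_eqF.
rewrite big_nat_recr//=; apply: le_trans (lerD IH (lexx _)) _.
set n : R := N.+1%:R; have n0 : 0 < n by rewrite ltr0n.
rewrite ler_pdivlMr// mulrDl divfK ?gt_eqF//.
have -> : n `^ (th - 1) = n `^ th / n.
  by rewrite powRB ?(gt_eqF n0) ?implybT// powRr1// ltW.
have [->|N0] := posnP N.
  by rewrite powR0 ?gt_eqF// add0r -mulrA ler_piMr ?powR_ge0// mulrC ler_pdivrMr// mul1r; rewrite (le_trans th1)// /n ler1n.
have N0' : (0 : R) < N%:R by rewrite ltr0n.
have q1 : 0 < N%:R / n by rewrite divr_gt0.
have h := powR_bernoulli q1 (ltW th0) th1.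
have e : (N%:R : R) = n * (N%:R / n) by rewrite mulrCA divff ?mulr1// gt_eqF.
rewrite {1}e powRM ?(ltW n0) ?(ltW q1)//.
apply: le_trans (lerD (ler_wpM2l (powR_ge0 _ _) h) (lexx _)) _.
have -> : N%:R = n - 1 by rewrite /n -natr1 addrK.
by rewrite le_eqVlt; apply/orP; left; apply/eqP; field; rewrite gt_eqF.
Qed.

Lemma powR_lower x y : 0 < x -> 1 + y * ln x <= x `^ y.
Proof. by move=> x0; rewrite powRE// expR_ge1Dx. Qed.

Lemma ln_le_sub1 x : 0 < x -> ln x <= x - 1.
Proof. by move=> x0; have := @le_ln1Dx R (x - 1); rewrite (_ : 1 + (x - 1) = x); [apply; lra|ring]. Qed.

Lemma powR_tail_term (th : R) n : 0 < th -> (0 < n)%N ->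
  (n.+1%:R : R) `^ (- 1 - th) <= (n%:R `^ (- th) - n.+1%:R `^ (- th)) / th.
Proof.
move=> th0 n0; set m : R := n.+1%:R; have m0 : 0 < m by rewrite ltr0n.
have n0' : (0 : R) < n%:R by rewrite ltr0n.
rewrite ler_pdivlMr//.
have -> : m `^ (- 1 - th) = m `^ (- th) / m.
  by rewrite addrC powRD ?(gt_eqF m0) ?implybT// powR_inv1 ?ltW.
have e : (n%:R : R) = m * (n%:R / m) by rewrite mulrCA divff ?mulr1// gt_eqF.
have q1 : 0 < n%:R / m by rewrite divr_gt0.
rewrite {1}e powRM ?(ltW m0) ?(ltW q1)//.
have h := powR_lower (- th) q1.
have h2 := ln_le_sub1 q1.
have h3 : 1 + th / m <= (n%:R / m) `^ (- th).
  apply: le_trans h; rewrite lerD2l mulNr -mulrN ler_wpM2l ?(ltW th0)//.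
  have : n%:R / m - 1 = - m^-1.
    have -> : n%:R = m - 1 by rewrite /m -natr1 addrK.
    by field; rewrite gt_eqF.
  by move=> e'; rewrite e' in h2; rewrite lerNr.
rewrite (_ : _ / m * th = m `^ (- th) * (1 + th / m) - m `^ (- th)); last by ring.
by rewrite lerD2r ler_wpM2l ?powR_ge0.
Qed.

(** Comparison with the integral of v^(-1 - th), in telescoping form. *)
Lemma sum_powR_tail_le (th : R) M N : 0 < th -> (0 < M)%N -> (M <= N)%N ->
  \sum_(M.+1 <= n < N.+1) (n%:R : R) `^ (- 1 - th) <= M%:R `^ (- th) / th.
Proof.
move=> th0 M0 MN.
suff : \sum_(M.+1 <= n < N.+1) (n%:R : R) `^ (- 1 - th) <=
    (M%:R `^ (- th) - N%:R `^ (- th)) / th.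
  move/le_trans; apply; rewrite ler_wpM2r ?invr_ge0 ?(ltW th0)//.
  by rewrite gerBl powR_ge0.
elim: N MN => [|N IH]; first by rewrite leqn0 => /eqP M1; rewrite M1 in M0.
rewrite leq_eqVlt => /orP[/eqP <-|MN]; first by rewrite big_geq// subrr mul0r.
rewrite big_nat_recr//=.
apply: le_trans (lerD (IH MN) (powR_tail_term th0 _)) _.
  exact: leq_trans M0 MN.
by rewrite le_eqVlt; apply/orP; left; apply/eqP; field; rewrite gt_eqF.
Qed.

Lemma powR_diff_le (rho : R) n : 0 < rho -> (0 < n)%N ->
  (n%:R : R) `^ (- rho) - n.+1%:R `^ (- rho) <= rho * n%:R `^ (- rho - 1).
Proof.
move=> r0 n0; have n0' : (0 : R) < n%:R by rewrite ltr0n.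
set m : R := n.+1%:R; have m0 : 0 < m by rewrite ltr0n.
have -> : n%:R `^ (- rho - 1) = n%:R `^ (- rho) / n%:R :> R.
  by rewrite powRB ?(gt_eqF n0') ?implybT// powRr1 ?ltW.
have e : m = n%:R * (m / n%:R) by rewrite mulrCA divff ?mulr1// gt_eqF.
have q1 : 0 < m / n%:R by rewrite divr_gt0.
rewrite {1}e powRM ?(ltW n0') ?(ltW q1)//.
have h := powR_lower (- rho) q1.
have h2 := ln_le_sub1 q1.
have h3 : 1 - rho / n%:R <= (m / n%:R) `^ (- rho).
  apply: le_trans h; rewrite lerD2l mulNr lerN2 ler_wpM2l ?(ltW r0)//.
  apply: le_trans h2 _; rewrite /m -natr1 le_eqVlt; apply/orP; left; apply/eqP.
  by field; rewrite gt_eqF.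
rewrite (_ : rho * _ = n%:R `^ (- rho) - n%:R `^ (- rho) * (1 - rho / n%:R)); last by ring.
by rewrite lerD2l lerN2 ler_wpM2l ?powR_ge0.
Qed.

End Elementary.

(** * Chebyshev's and Mertens' estimates *)

Section Primorial.
Local Open Scope nat_scope.

Lemma prod_primes_dvd (a b N : nat) :
  (forall p, a <= p < b -> prime p -> p %| N) ->
  \prod_(a <= p < b | prime p) p %| N.
Proof.
elim: b => [|b IH] h; first by rewrite big_geq// dvd1n.
have [ab|ba] := leqP a b; last by rewrite big_geq// dvd1n.
have {}IH : \prod_(a <= p < b | prime p) p %| N.
  by apply: IH => p /andP[h1 h2]; apply: h; rewrite h1 ltnW.
rewrite big_mkcond big_nat_recr//= -big_mkcond/=.
case: ifP => pb; last by rewrite muln1.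
rewrite Gauss_dvd ?IH ?h ?ab ?ltnSn//.
rewrite big_nat_cond; elim/big_ind: _ => [|x y hx hy|p /andP[/andP[_ pb'] pp]].
- exact: coprime1n.
- by rewrite coprimeMl hx.
- rewrite prime_coprime// dvdn_prime2//; apply: contraTneq pb' => ->.
  by rewrite ltnn.
Qed.

Lemma prime_dvd_fact p n : prime p -> p %| n`! -> p <= n.
Proof.
move=> pp; elim: n => [|n IH]; first by rewrite fact0 dvdn1 => /eqP p1; rewrite p1 in pp.
rewrite factS Euclid_dvdM// => /orP[/dvdn_leq->//|/IH h]; exact: leqW.
Qed.

Lemma prime_dvd_bin m p : prime p -> m.+1 < p <= (2 * m).+1 -> p %| 'C((2 * m).+1, m).
Proof.
move=> pp /andP[p1 p2].
have hm : m <= (2 * m).+1 by lia.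
have h := bin_fact hm.
have : p %| (2 * m).+1`! by apply: dvdn_fact; rewrite prime_gt0.
rewrite -h !Euclid_dvdM// => /or3P[//| |] /(prime_dvd_fact pp); lia.
Qed.

Lemma bin_mid_le m : 'C((2 * m).+1, m) <= 4 ^ m.
Proof.
suff : 2 * 'C((2 * m).+1, m) <= 2 ^ (2 * m).+1.
  by rewrite expnS leq_pmul2l// expnM.
have h := expnDn 1 1 (2 * m).+1; rewrite (_ : 1 + 1 = 2)// in h; rewrite h.
have e : \sum_(i < (2 * m).+2) 'C((2 * m).+1, i) * (1 ^ ((2 * m).+1 - i) * 1 ^ i)
   = \sum_(i < (2 * m).+2) 'C((2 * m).+1, i).
  by apply: eq_bigr => i _; rewrite !exp1n !muln1.
rewrite e.
have m1 : m < (2 * m).+2 by lia.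
have m2 : m.+1 < (2 * m).+2 by lia.
rewrite (bigD1 (Ordinal m1))//= (bigD1 (Ordinal m2))/=; last first.
  by apply/eqP => /(congr1 val)/=; lia.
have -> : 'C((2 * m).+1, m.+1) = 'C((2 * m).+1, m).
  by rewrite (_ : m.+1 = (2 * m).+1 - m) ?bin_sub//; lia.
by rewrite addnA mulSn mul1n leq_addr.
Qed.

(** Erdos' induction: the primes in (m + 1, 2m + 1] divide the central
    binomial coefficient C(2m + 1, m) <= 4^m. *)
Lemma primorial_le n : \prod_(1 <= p < n.+1 | prime p) p <= 4 ^ n.
Proof.
elim/ltn_ind: n => n IH.
have [n2|n2] := leqP n 2.
  case: n n2 {IH} => [|[|[|//]]] _; first by rewrite big_geq.
    by rewrite big_mkcond big_nat1.
  by rewrite big_mkcond unlock.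
have [no|ne] := boolP (odd n); last first.
  case: n n2 ne IH => // n n2 ne IH.
  rewrite big_mkcond big_nat_recr//= -big_mkcond/= ifN.
    by rewrite muln1; apply: leq_trans (IH n _) _; rewrite ?ltnSn// leq_exp2l.
  by apply: contra ne => pn; case: (even_prime pn) n2 => [->|//].
pose m := n./2; have nE : n = (2 * m).+1.
  by rewrite -[LHS]odd_double_half no add1n -mul2n.
have m0 : 0 < m by move: n2; rewrite nE; lia.
rewrite (big_cat_nat (n := m.+2)) ?nE//=; last by lia.
have -> : 4 ^ (2 * m).+1 = 4 ^ m.+1 * 4 ^ m by rewrite -expnD; congr expn; lia.
apply: leq_mul; first by apply: IH; rewrite nE; lia.
apply: leq_trans (bin_mid_le m).
apply: dvdn_leq; first by rewrite bin_gt0; lia.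
by apply: prod_primes_dvd => p hp pp; apply: prime_dvd_bin.
Qed.

End Primorial.

Section Mertens.
Variable R : realType.

Lemma ln_prod_nat (r : seq nat) (P : pred nat) (F : nat -> nat) :
  (forall i, P i -> (0 < F i)%N) ->
  ln ((\prod_(i <- r | P i) F i)%N%:R : R) = \sum_(i <- r | P i) ln (F i)%:R.
Proof.
move=> h.
suff : ln ((\prod_(i <- r | P i) F i)%N%:R : R) = \sum_(i <- r | P i) ln (F i)%:R /\
  (0 < \prod_(i <- r | P i) F i)%N by case.
elim/big_rec2: _ => [|i x y Pi [e y0]]; first by rewrite ln1.
by rewrite natrM lnM ?posrE ?ltr0n ?h// e muln_gt0 h.
Qed.

Lemma ln2_le1 : ln 2 <= 1 :> R.
Proof.
rewrite -[leRHS]expRK ler_ln ?posrE ?expR_gt0//.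
by apply: le_trans (expR_ge1Dx 1); lra.
Qed.

Lemma chebyshev_theta_le n : \sum_(1 <= p < n.+1 | prime p) ln (p%:R : R) <= 2 * n%:R.
Proof.
rewrite -ln_prod_nat; last by move=> i; exact: prime_gt0.
apply: le_trans (_ : ln ((4 ^ n)%N%:R) <= _).
  rewrite ler_ln ?posrE ?ltr0n ?expn_gt0//; first by rewrite ler_nat primorial_le.
  by rewrite prodn_cond_gt0// => i; exact: prime_gt0.
have l4 : ln 4 <= 2 :> R.
  rewrite (_ : 4 = 2 * 2 :> R); last by ring.
  by rewrite lnM ?posrE//; have := ln2_le1; lra.
by rewrite natrX lnXn// -[leLHS]mulr_natr ler_wpM2r.
Qed.

Lemma ln_fact n : ln (n`!%:R : R) =
  \sum_(1 <= p < n.+1 | prime p) (logn p n`!)%:R * ln p%:R.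
Proof.
have e : n`! = (\prod_(1 <= p < n.+1 | prime p) p ^ logn p n`!)%N.
  rewrite -{1}[n`!]partnT ?fact_gt0// /partn.
  rewrite (big_cat_nat (n := n.+1))//=; last by rewrite ltnS fact_geq.
  rewrite [X in (_ * X)%N]big1_seq ?muln1; last first.
    move=> p /andP[_]; rewrite mem_index_iota => /andP[np _].
    rewrite -[RHS](expn0 p); congr expn.
    rewrite lognE; case: ifP => // /and3P[pp _ /(prime_dvd_fact pp)].
    by rewrite leqNgt np.
  rewrite big_ltn_cond//= lognE /= expn0 mul1n [RHS]big_mkcond.
  apply: eq_bigr => p _.
  by case: ifP => // pp; rewrite lognE pp expn0.
rewrite {1}e ln_prod_nat; last by move=> p pp; rewrite expn_gt0 prime_gt0.
by apply: eq_bigr => p pp; rewrite natrX lnXn ?ltr0n ?prime_gt0// mulr_natl.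
Qed.

Lemma ln_fact_le n : ln (n`!%:R : R) <= n%:R * ln n%:R.
Proof.
have [->|n0] := posnP n; first by rewrite fact0 ln1 mul0r.
have n0' : (0 : R) < n%:R by rewrite ltr0n.
rewrite mulr_natl -lnXn// ler_ln ?posrE ?exprn_gt0 ?ltr0n ?fact_gt0//.
rewrite -natrX ler_nat; elim: {n0 n0'} n => // n IH.
rewrite factS expnS leq_mul2l /=; apply: leq_trans IH _.
by case: n => // n; rewrite leq_exp2r.
Qed.

Lemma ln_fact_ge n : n%:R * ln n%:R - n%:R <= ln (n`!%:R : R).
Proof.
have [->|n0] := posnP n; first by rewrite fact0 ln1 mul0r subr0.
have n0' : (0 : R) < n%:R by rewrite ltr0n.
case: n n0 n0' => // n _ n0'.
have f0 : (0 : R) < (n.+1)`!%:R by rewrite ltr0n fact_gt0.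
have h := @expR_ge1Dxn R n.+1%:R n (ltW n0').
have : n.+1%:R ^+ n.+1 / (n.+1)`!%:R <= expR n.+1%:R :> R by apply: le_trans h; rewrite lerDr.
rewrite -ler_ln ?posrE ?expR_gt0 ?divr_gt0 ?exprn_gt0//.
rewrite expRK ln_div ?posrE ?exprn_gt0// lnXn// -mulr_natl; lra.
Qed.

Definition mertens_sum n : R := \sum_(1 <= p < n.+1 | prime p) ln p%:R / p%:R.

Lemma ln_nat_ge0 n : 0 <= ln (n%:R : R).
Proof. by case: n => [|n]; [rewrite ln0|rewrite ln_ge0// ler1n]. Qed.

(** The exponent of p in n! is at least n/p - 1; Chebyshev's bound absorbs
    the -1. *)
Lemma mertens_sum_le n : (0 < n)%N -> mertens_sum n <= ln n%:R + 2.
Proof.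
move=> n0; have n0' : (0 : R) < n%:R by rewrite ltr0n.
have h1 := ln_fact_le n; rewrite ln_fact in h1.
have h2 : \sum_(1 <= p < n.+1 | prime p) (n%:R / p%:R - 1) * ln p%:R <=
   \sum_(1 <= p < n.+1 | prime p) (logn p n`!)%:R * ln (p%:R : R).
  rewrite big_nat_cond [leRHS]big_nat_cond.
  apply: ler_sum => p /andP[/andP[p1 pn] pp].
  rewrite ler_wpM2r ?ln_nat_ge0//.
  have p0 : (0 : R) < p%:R by rewrite ltr0n.
  apply: le_trans (_ : (n %/ p)%:R <= _).
    rewrite lerBlDr ler_pdivrMr// natr1 -natrM ler_nat ltnW//.
    by rewrite ltn_ceil// prime_gt0.
  by rewrite ler_nat logn_fact// big_ltn ?ltnS// expn1 leq_addr.
have h3 := chebyshev_theta_le n.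
have e : \sum_(1 <= p < n.+1 | prime p) (n%:R / p%:R - 1) * ln p%:R =
   n%:R * mertens_sum n - \sum_(1 <= p < n.+1 | prime p) ln (p%:R : R).
  by rewrite /mertens_sum big_distrr/= -sumrB; apply: eq_bigr => p _; ring.
rewrite e in h2.
rewrite -(ler_pM2l n0') mulrDr.
move: (le_trans h2 h1) h3; lra.
Qed.

Lemma logn_fact_le p n : prime p -> (logn p n`!)%:R <= n%:R / (p%:R - 1) :> R.
Proof.
move=> pp; have p1 : (1 : R) < p%:R by rewrite ltr1n prime_gt1.
have p0 : (0 : R) < p%:R by lra.
have p10 : (0 : R) < p%:R - 1 by lra.
rewrite logn_fact//.
suff h K : (\sum_(1 <= k < K.+1) n %/ p ^ k)%:R <= n%:R / (p%:R - 1) * (1 - (p%:R ^+ K)^-1) :> R.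
  apply: le_trans (h n) _; rewrite ler_piMr ?divr_ge0 ?(ltW p10)// gerBl invr_ge0 exprn_ge0// ltW.
elim: K => [|K IH]; first by rewrite big_geq// expr0 invr1 subrr mulr0.
rewrite big_nat_recr//= natrD; apply: le_trans (lerD IH (_ : _ <= n%:R / p%:R ^+ K.+1)) _.
  by rewrite ler_pdivlMr ?exprn_gt0// -natrX -natrM ler_nat leq_divM.
rewrite le_eqVlt; apply/orP; left; apply/eqP; rewrite exprS; field.
by rewrite !gt_eqF// exprn_gt0.
Qed.

(** (2 + ln m)/m is a discrete primitive which makes the sum of
    ln p / (p (p - 1)) telescope. *)
Lemma ln_telescope m : (1 < m)%N -> ln (m%:R : R) / (m%:R * (m%:R - 1)) <=
  (2 + ln m.-1%:R) / m.-1%:R - (2 + ln m%:R) / m%:R.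
Proof.
case: m => // m; rewrite ltnS => m0 /=; have m0' : (0 : R) < m%:R by rewrite ltr0n.
rewrite -natr1 addrK; set y : R := m%:R in m0' *.
have y1 : 0 < y + 1 by lra.
have h : ln (y + 1) <= ln y + y^-1.
  have -> : y + 1 = y * (1 + y^-1) by rewrite mulrDr mulr1 divff// gt_eqF.
  rewrite lnM ?posrE ?addr_gt0 ?invr_gt0// lerD2l le_ln1Dx//.
  by apply: lt_trans (_ : 0 < _); [lra|rewrite invr_gt0].
have yi : y^-1 <= 1 by rewrite invf_le1// /y ler1n.
rewrite (_ : (2 + ln y) / y - (2 + ln (y + 1)) / (y + 1) =
   ((2 + ln y) * (y + 1) - (2 + ln (y + 1)) * y) / ((y + 1) * y)); last first.
  by field; rewrite !gt_eqF.
rewrite ler_pM2r ?invr_gt0 ?mulr_gt0//.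
have h2 : y * ln (y + 1) <= y * ln y + 1.
  have := ler_wpM2l (ltW m0') h; rewrite mulrDr divff// gt_eqF//.
lra.
Qed.

Lemma sum_ln_prime_sq_le n : \sum_(1 <= p < n.+1 | prime p) ln (p%:R : R) / (p%:R * (p%:R - 1)) <= 2.
Proof.
have [->|n0] := posnP n; first by rewrite big_geq.
apply: le_trans (_ : 2 - (2 + ln n%:R) / n%:R <= _); last first.
  by rewrite gerBl divr_ge0// addr_ge0// ln_nat_ge0.
case: n n0 => // n _; elim: n => [|n IH].
  by rewrite big_mkcond big_nat1 /= ln1 addr0 divr1 subrr.
rewrite big_mkcond big_nat_recr//= -big_mkcond/=.
have h := @ln_telescope n.+2 isT.
apply: le_trans (lerD IH (_ : _ <= ln n.+2%:R / (n.+2%:R * (n.+2%:R - 1)))) _.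
  case: ifP => // _; rewrite divr_ge0 ?ln_nat_ge0// mulr_ge0// subr_ge0 ler1n//.
move: h; rewrite /=; set A := _ / _; set B := _ / _; set C := _ / _; lra.
Qed.

(** The exponent of p in n! is at most n/(p - 1) = n/p + n/(p (p - 1)), and
    the second term contributes O(n). *)
Lemma mertens_sum_ge n : (0 < n)%N -> ln n%:R - 3 <= mertens_sum n.
Proof.
move=> n0; have n0' : (0 : R) < n%:R by rewrite ltr0n.
have h1 := ln_fact_ge n; rewrite ln_fact in h1.
have h2 : \sum_(1 <= p < n.+1 | prime p) (logn p n`!)%:R * ln (p%:R : R) <=
  \sum_(1 <= p < n.+1 | prime p) (n%:R * (ln p%:R / p%:R) +
     n%:R * (ln (p%:R : R) / (p%:R * (p%:R - 1)))).
  apply: ler_sum => p pp; have p1 : (1 : R) < p%:R by rewrite ltr1n prime_gt1.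
  have p0 : (0 : R) < p%:R by lra.
  have p10 : (0 : R) < p%:R - 1 by lra.
  apply: le_trans (ler_wpM2r (ln_nat_ge0 _) (logn_fact_le _ pp)) _.
  by rewrite le_eqVlt; apply/orP; left; apply/eqP; field; rewrite !gt_eqF.
rewrite big_split/= -!big_distrr /= -/(mertens_sum n) in h2.
have h3 := ler_wpM2l (ltW n0') (sum_ln_prime_sq_le n).
rewrite -(ler_pM2l n0') mulrBr.
move: (le_trans h1 h2) h3; lra.
Qed.

Lemma mertens_sum_bounds (z : R) : 1 <= z ->
  ln z - 4 <= mertens_sum (Num.truncn z) <= ln z + 2.
Proof.
move=> z1; have z0 := lt_le_trans ltr01 z1.
set n := Num.truncn z; have n0 : (0 < n)%N by rewrite truncn_gt0.
have n0' : (0 : R) < n%:R by rewrite ltr0n.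
have /andP[h1 h2] := truncn_itv (ltW z0).
have a1 : ln n%:R <= ln z by rewrite ler_ln ?posrE.
have a2 : ln z <= ln n%:R + 1.
  apply: le_trans (_ : ln (2 * n%:R) <= _).
    rewrite ler_ln ?posrE ?mulr_gt0//; apply: le_trans (ltW h2) _.
    rewrite -/n -natr1; have : (1 : R) <= n%:R by rewrite ler1n.
    lra.
  by rewrite lnM ?posrE//; have := ln2_le1; lra.
have := mertens_sum_le n0; have := mertens_sum_ge n0; move=> b1 b2.
by apply/andP; split; lra.
Qed.

End Mertens.

(** * A window of primes where h is far from 1 *)

Section Window.
Variable R : realType.
Implicit Types (z lP : R) (wt : nat -> R).

(** The interval is given by the logarithms of its endpoints: the scales of
    the proof are multiples of ln (ln x). *)
Definition window z z' : seq nat :=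
  [seq p <- index_iota (Num.truncn (expR z)).+1 (Num.truncn (expR z')).+1 | prime p].

Lemma window_prime z z' : all prime (window z z').
Proof. by apply/allP => p; rewrite mem_filter => /andP[]. Qed.

Lemma window_uniq z z' : uniq (window z z').
Proof. by rewrite filter_uniq// iota_uniq. Qed.

Lemma window_ln z z' p : p \in window z z' -> z < ln (p%:R : R) <= z'.
Proof.
rewrite mem_filter mem_index_iota ltnS => /and3P[pp p1 p2].
have p0 : (0 : R) < p%:R by rewrite ltr0n prime_gt0.
apply/andP; split.
  rewrite -[ltLHS]expRK ltr_ln ?posrE ?expR_gt0//.
  by apply: lt_le_trans (truncnS_gt _) _; rewrite ler_nat.
rewrite -[leRHS]expRK ler_ln ?posrE ?expR_gt0//.
by apply: le_trans (_ : (Num.truncn (expR z'))%:R <= _); rewrite ?ler_nat ?truncn_le ?expR_ge0.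
Qed.

Definition weighted_mertens wt z : R :=
  \sum_(1 <= p < (Num.truncn (expR z)).+1 | prime p) wt p / p%:R * ln p%:R.

Lemma weighted_mertensB wt z z' : z <= z' ->
  weighted_mertens wt z' - weighted_mertens wt z = \sum_(p <- window z z') wt p / p%:R * ln p%:R.
Proof.
move=> zz; rewrite /weighted_mertens (big_cat_nat (n := (Num.truncn (expR z)).+1))//=; last first.
  by rewrite ltnS le_truncn// ler_expR.
by rewrite addrAC subrr add0r /window big_filter.
Qed.

Lemma weighted_mertens1 z : weighted_mertens (fun=> 1) z = mertens_sum R (Num.truncn (expR z)).
Proof. by apply: eq_bigr => p _; rewrite mul1r mulrC. Qed.

Lemma weighted_mertens1_bounds z : 0 <= z -> z - 4 <= weighted_mertens (fun=> 1) z <= z + 2.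
Proof.
move=> z0; rewrite weighted_mertens1; have := @mertens_sum_bounds R (expR z); rewrite expRK; apply.
by rewrite -expR0 ler_expR.
Qed.

Lemma weighted_mertensB_le wt wt' z z' : z <= z' -> (forall p, prime p -> wt p <= wt' p) ->
  weighted_mertens wt z' - weighted_mertens wt z <= weighted_mertens wt' z' - weighted_mertens wt' z.
Proof.
move=> zz h; rewrite !weighted_mertensB// big_seq [leRHS]big_seq; apply: ler_sum => p.
rewrite mem_filter => /andP[pp _].
by rewrite !ler_wpM2r ?ln_nat_ge0 ?invr_ge0 ?h.
Qed.

Lemma bernoulli_ineq (n : nat) (c : R) : 0 <= c -> 1 + n%:R * c <= (1 + c) ^+ n.
Proof.
move=> c0; elim: n => [|n IH]; first by rewrite mul0r addr0 expr0.
rewrite exprS -natr1.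
have := ler_wpM2l (addr_ge0 ler01 c0) IH; apply: le_trans.
have : 0 <= n%:R * c ^+ 2 by rewrite mulr_ge0 ?sqr_ge0.
rewrite expr2; lra.
Qed.

(** Pigeonhole over the windows (u_(j+1), u_j] with u_j = (1 - eta) L
    (20/21)^j, as long as u_j > (19/10) eta L.  On such a window the weighted
    sum of ln p / p is at most u_j times the weighted sum of 1/p, and
    u_j = 21 (u_j - u_(j+1)), so that a lack of dense windows bounds the total
    by (21/250) eta L.  Mertens' estimate shows that it is at least
    eta L/10 - 8. *)
Lemma exists_dense_window wt (eta L : R) :
  (forall p, prime p -> 0 <= wt p <= 1) ->
  0 < eta -> eta <= 1 / 100 -> 600 <= eta * L ->
  3 * eta * L <= weighted_mertens wt L ->
  exists lP, [/\ 9 / 5 * eta * L <= lP, 21 / 20 * lP <= (1 - eta) * L &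
    eta / 250 <= \sum_(p <- window lP (21 / 20 * lP)) wt p / p%:R].
Proof.
move=> hwt e0 e1 eL hS.
have L0 : 0 < L by rewrite -(pmulr_rgt0 _ e0); lra.
apply: contrapT => hno.
have hno' lP : 9 / 5 * eta * L <= lP -> 21 / 20 * lP <= (1 - eta) * L ->
    \sum_(p <- window lP (21 / 20 * lP)) wt p / p%:R < eta / 250.
  by move=> h1 h2; rewrite ltNge; apply/negP => h3; apply: hno; exists lP.
pose u0 := (1 - eta) * L.
pose u n := u0 * (20 / 21) ^+ n.
have uS n : u n = 21 / 20 * u n.+1 by rewrite /u exprS; field.
have u00 : 0 < u0 by rewrite mulr_gt0//; lra.
have un0 n : 0 < u n by rewrite mulr_gt0// exprn_gt0.
have u_le n : u n <= u0 by rewrite /u ler_piMr ?(ltW u00)// exprn_ile1//; lra.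
have hex : exists n, u n <= 19 / 10 * eta * L.
  have d0 : 0 < 19 / 10 * eta * L by rewrite !mulr_gt0.
  pose b := u0 / (19 / 10 * eta * L).
  exists (20 * (Num.truncn b).+1)%N; set n := (20 * _)%N.
  have hb : b <= (1 + 1 / 20) ^+ n.
    have c0 : 0 <= 1 / 20 :> R by lra.
    apply: le_trans (bernoulli_ineq n c0); apply: le_trans (ltW (truncnS_gt b)) _.
    by rewrite /n natrM; set k := (Num.truncn b).+1%:R; lra.
  have pn : 0 < (1 + 1 / 20) ^+ n :> R by rewrite exprn_gt0//; lra.
  rewrite /b ler_pdivrMr// in hb.
  rewrite /u (_ : 20 / 21 = (1 + 1 / 20)^-1); last by field.
  by rewrite exprVn ler_pdivrMr// mulrC.
pose J := ex_minn hex.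
have [J1 J2] : u J <= 19 / 10 * eta * L /\ forall n, (n < J)%N -> 19 / 10 * eta * L < u n.
  rewrite /J; case: ex_minnP => m h1 h2; split => // n nm.
  by rewrite ltNge; apply/negP => /h2; rewrite leqNgt nm.
have tele n : (n <= J)%N -> weighted_mertens wt u0 - weighted_mertens wt (u n) <= 21 * (eta / 250) * (u0 - u n).
  elim: n => [|n IH] nJ; first by rewrite /u expr0 mulr1 !subrr mulr0.
  have h1 := IH (ltnW nJ).
  have un := J2 n nJ.
  have uSn := uS n.
  have hl : 9 / 5 * eta * L <= u n.+1.
    move: un; rewrite uSn; set y := u n.+1; move: e0 eL; nra.
  have hu : 21 / 20 * u n.+1 <= (1 - eta) * L by rewrite -uSn u_le.
  have hw := hno' _ hl hu; rewrite -uSn in hw.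
  have uu : u n.+1 <= u n by rewrite uSn; have := un0 n.+1; lra.
  have h2 := weighted_mertensB wt uu.
  have h3 : weighted_mertens wt (u n) - weighted_mertens wt (u n.+1) <= u n * (eta / 250).
    rewrite h2; apply: le_trans (_ : u n * \sum_(p <- window (u n.+1) (u n)) wt p / p%:R <= _).
      rewrite big_distrr/= big_seq [leRHS]big_seq; apply: ler_sum => p pw.
      have /andP[_ lp] := window_ln pw.
      move: pw; rewrite mem_filter => /andP[pp _].
      rewrite [leRHS]mulrC ler_wpM2l// divr_ge0//; by have /andP[] := hwt p pp.
    by rewrite ler_wpM2l ?(ltW (un0 n))// ltW.
  have e21 : u n - u n.+1 = u n / 21 by rewrite uSn; field.
  have : 21 * (eta / 250) * (u n - u n.+1) = u n * (eta / 250) by rewrite e21; field.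
  move: h1 h3; lra.
(* The primes with logarithm outside (u_J, u_0] are removed with Mertens'
   estimate. *)
have hJ := tele J (leqnn J).
have hu0L : u0 <= L by rewrite /u0; move: e0 L0; nra.
have p1 p : prime p -> wt p <= 1 by move=> /hwt/andP[].
have hA := weighted_mertensB_le (wt' := fun=> 1) hu0L p1.
have /andP[a1 a2] := weighted_mertens1_bounds (ltW L0).
have /andP[b1 b2] := weighted_mertens1_bounds (ltW u00).
have /andP[c1 c2] := weighted_mertens1_bounds (ltW (un0 J)).
have hB : weighted_mertens wt (u J) <= weighted_mertens (fun=> 1) (u J).
  apply: ler_sum => p pp; rewrite !ler_wpM2r ?ln_nat_ge0 ?invr_ge0//.
  exact: p1.
have hu : 21 * (eta / 250) * (u0 - u J) <= 21 * (eta / 250) * L.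
  by apply: ler_wpM2l; [move: e0; lra|have := un0 J; lra].
have e : u0 = L - eta * L by rewrite /u0; ring.
have : eta * L * (21 / 250) = 21 * (eta / 250) * L by field.
move: hJ hA a2 b1 c2 hB hu J1 hS eL; rewrite e.
have -> : 3 * eta * L = 3 * (eta * L) by ring.
have -> : 19 / 10 * eta * L = 19 / 10 * (eta * L) by ring.
set y := eta * L.
set w1 := weighted_mertens wt _; set w2 := weighted_mertens wt (u J); set w3 := weighted_mertens wt L; set w4 := weighted_mertens _ L; set w5 := weighted_mertens _ (L - y).
set w6 := weighted_mertens _ (u J); set w7 := 21 * _ * (_ - _); set w8 := 21 * _ * L.
lra.
Qed.

End Window.

(** * Complex powers of positive reals *)

Local Notation re := complex.Re.
Local Notation im := complex.Im.
Local Open Scope complex_scope.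

Section Cpow.
Variable R : realType.
Implicit Types (x y a b t u : R).

(** The complex power x^(a + i t) of a positive real x. *)
Definition cpow x a t : R[i] :=
  (x `^ a * cos (t * ln x)) +i* (x `^ a * sin (t * ln x)).

Lemma cpowM x y a t : 0 < x -> 0 < y ->
  cpow (x * y) a t = cpow x a t * cpow y a t.
Proof.
move=> x0 y0; rewrite /cpow powRM ?ltW// lnM ?posrE// mulrDr cosD sinD.
by apply/eqP; rewrite eq_complex /=; apply/andP; split; apply/eqP; ring.
Qed.

Lemma cpowD x a b t u : 0 < x ->
  cpow x (a + b) (t + u) = cpow x a t * cpow x b u.
Proof.
move=> x0; rewrite /cpow powRD ?(gt_eqF x0) ?implybT// mulrDl cosD sinD.
by apply/eqP; rewrite eq_complex /=; apply/andP; split; apply/eqP; ring.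
Qed.

Lemma normc_cpow x a t : normc (cpow x a t) = x `^ a.
Proof.
rewrite /normc /cpow /= !exprMn -mulrDr cos2Dsin2 mulr1 sqrtr_sqr.
by rewrite ger0_norm// powR_ge0.
Qed.

Lemma normc_real (r : R) : normc r%:C = `|r|.
Proof. by rewrite /normc /= expr0n /= addr0 sqrtr_sqr. Qed.

Lemma normcB (z w : R[i]) : normc (z - w) <= normc z + normc w.
Proof. by rewrite -(normcN w) le_normcD. Qed.

Lemma normc_ge0 (z : R[i]) : 0 <= normc z.
Proof. by case: z => p q; rewrite sqrtr_ge0. Qed.

Lemma normc_sum (I : Type) (r : seq I) (P : pred I) (F : I -> R[i]) :
  normc (\sum_(i <- r | P i) F i) <= \sum_(i <- r | P i) normc (F i).
Proof.
elim/big_rec2: _ => [|i y1 y2 _ h]; first by rewrite normc0.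
by rewrite (le_trans (le_normcD _ _))// lerD2l.
Qed.

Lemma cpow1 a t : cpow 1 a t = 1.
Proof. by rewrite /cpow powR1 ln1 mulr0 cos0 sin0 mulr1 mulr0. Qed.

Lemma is_derive_cpow_Re x a t : 0 < x ->
  is_derive x 1 (fun v => re (cpow v a t)) (re ((a +i* t) * cpow x (a - 1) t)).
Proof.
move=> x0; have h1 := is_derive1_powR a x0.
have h2 := is_derive1_ln x0.
have h3 : is_derive x 1 (fun v => t * ln v) (t * x^-1) by apply: is_deriveZ.
have h4 : is_derive x 1 (fun v => cos (t * ln v)) (- sin (t * ln x) * (t * x^-1)).
  exact: (@is_derive1_comp _ cos).
have := is_deriveM h1 h4; rewrite /cpow /= /GRing.scale/=.
move/is_derive_eq; apply.
rewrite powRB ?powRr1 ?ltW// ?(gt_eqF x0) ?implybT//.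
by field; rewrite gt_eqF.
Qed.

Lemma is_derive_cpow_Im x a t : 0 < x ->
  is_derive x 1 (fun v => im (cpow v a t)) (im ((a +i* t) * cpow x (a - 1) t)).
Proof.
move=> x0; have h1 := is_derive1_powR a x0.
have h2 := is_derive1_ln x0.
have h3 : is_derive x 1 (fun v => t * ln v) (t * x^-1) by apply: is_deriveZ.
have h4 : is_derive x 1 (fun v => sin (t * ln v)) (cos (t * ln x) * (t * x^-1)).
  exact: (@is_derive1_comp _ sin).
have := is_deriveM h1 h4; rewrite /cpow /= /GRing.scale/=.
move/is_derive_eq; apply.
rewrite powRB ?powRr1 ?ltW// ?(gt_eqF x0) ?implybT//.
by field; rewrite gt_eqF.
Qed.

Definition is_cderive x (F : R -> R[i]) (d : R[i]) :=
  is_derive x 1 (fun v => re (F v)) (re d) /\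
  is_derive x 1 (fun v => im (F v)) (im d).

Lemma is_cderive_cpow x a t : 0 < x ->
  is_cderive x (fun v => cpow v a t) ((a +i* t) * cpow x (a - 1) t).
Proof. by move=> x0; split; [exact: is_derive_cpow_Re|exact: is_derive_cpow_Im]. Qed.

Lemma is_cderiveD x F G d e : is_cderive x F d -> is_cderive x G e ->
  is_cderive x (fun v => F v + G v) (d + e).
Proof.
move=> [h1 h2] [h3 h4]; split.
- have -> : (fun v => re (F v + G v)) = (fun v => re (F v)) \+ (fun v => re (G v)).
    by apply/funext => v /=; case: (F v); case: (G v).
  have -> : re (d + e) = re d + re e by case: d {h1 h2}; case: e {h3 h4}.
  exact: is_deriveD.
- have -> : (fun v => im (F v + G v)) = (fun v => im (F v)) \+ (fun v => im (G v)).
    by apply/funext => v /=; case: (F v); case: (G v).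
  have -> : im (d + e) = im d + im e by case: d {h1 h2}; case: e {h3 h4}.
  exact: is_deriveD.
Qed.

Lemma is_cderiveZ x F d c : is_cderive x F d ->
  is_cderive x (fun v => c * F v) (c * d).
Proof.
move=> [h1 h2]; case: c => p q; split.
- have -> : (fun v => re ((p +i* q) * F v)) =
      (fun v => p * re (F v)) \- (fun v => q * im (F v)).
    by apply/funext => v /=; case: (F v).
  have -> : re ((p +i* q) * d) = p * re d - q * im d by case: d {h1 h2}.
  by apply: is_deriveB; apply: is_deriveZ.
- have -> : (fun v => im ((p +i* q) * F v)) =
      (fun v => p * im (F v)) \+ (fun v => q * re (F v)).
    by apply/funext => v /=; case: (F v).
  have -> : im ((p +i* q) * d) = p * im d + q * re d by case: d {h1 h2}.
  by apply: is_deriveD; apply: is_deriveZ.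
Qed.

Lemma is_cderive_realM x F d (k : R -> R) k' : is_derive x 1 k k' ->
  is_cderive x F d ->
  is_cderive x (fun v => (k v)%:C * F v) ((k x)%:C * d + k'%:C * F x).
Proof.
move=> hk [h1 h2]; split.
- have -> : (fun v => re ((k v)%:C * F v)) = (fun v => k v * re (F v)).
    by apply/funext => v /=; case: (F v) => p q /=; rewrite mul0r subr0.
  have := is_deriveM hk h1; move/is_derive_eq; apply.
  rewrite /GRing.scale/=; case: d {h1 h2} => p q; case: (F x) => p' q' /=.
  by rewrite !mul0r !subr0 [p' * _]mulrC.
- have -> : (fun v => im ((k v)%:C * F v)) = (fun v => k v * im (F v)).
    by apply/funext => v /=; case: (F v) => p q /=; rewrite mul0r addr0.
  have := is_deriveM hk h2; move/is_derive_eq; apply.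
  rewrite /GRing.scale/=; case: d {h1 h2} => p q; case: (F x) => p' q' /=.
  by rewrite !mul0r !addr0 [q' * _]mulrC.
Qed.

Lemma cauchy_schwarz_complex (z w : R[i]) :
  re z * re w + im z * im w <= normc z * normc w.
Proof.
case: z => p q; case: w => p' q' /=.
rewrite -sqrtrM ?addr_ge0 ?sqr_ge0//.
apply: (le_trans (ler_norm _)); rewrite -sqrtr_sqr ler_wsqrtr//.
by rewrite -subr_ge0 (_ : _ - _ = (p * q' - q * p') ^+ 2) ?sqr_ge0//; ring.
Qed.

(** Project F on the direction of F b - F a and compare the real function
    obtained with f. *)
Lemma mean_value_ineq (F F' : R -> R[i]) (f f' : R -> R) a b : a <= b ->
  (forall x, a <= x <= b -> is_cderive x F (F' x)) ->
  (forall x, a <= x <= b -> is_derive x 1 f (f' x)) ->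
  (forall x, a <= x <= b -> normc (F' x) <= f' x) ->
  normc (F b - F a) <= f b - f a.
Proof.
move=> ab hF hf hle; set D := F b - F a.
have [D0|D0] := eqVneq (normc D) 0.
  rewrite D0 subr_ge0.
  apply: (@ger0_derive1_le_cc _ f a b); rewrite ?in_itv/= ?lexx ?ab//.
  - by move=> x; rewrite in_itv/= => /andP[ax xb]; have [] := hf x; rewrite ?(ltW ax) ?(ltW xb).
  - move=> x; rewrite in_itv/= => /andP[ax xb].
    have xab : a <= x <= b by rewrite ?(ltW ax) ?(ltW xb).
    have h := hf x xab.
    by rewrite derive1E derive_val (le_trans (normc_ge0 _) (hle _ xab)).
  - apply: derivable_within_continuous => x; rewrite in_itv/= => xab.
    by have [] := hf x xab.
have Dgt0 : 0 < normc D by rewrite lt_def D0 normc_ge0.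
pose p := re D / normc D; pose q := im D / normc D.
pose g := f - (fun v => p * re (F v) + q * im (F v)).
have hg x : a <= x <= b -> is_derive x 1 g (f' x - (p * re (F' x) + q * im (F' x))).
  move=> xab; have [h1 h2] := hF x xab; have h3 := hf x xab.
  by apply: is_deriveB; apply: is_deriveD; apply: is_deriveZ.
have : g a <= g b.
  apply: (@ger0_derive1_le_cc _ g a b); rewrite ?in_itv/= ?lexx ?ab//.
  - by move=> x; rewrite in_itv/= => /andP[ax xb]; have [] := hg x; rewrite ?(ltW ax) ?(ltW xb).
  - move=> x; rewrite in_itv/= => /andP[ax xb].
    have xab : a <= x <= b by rewrite ?(ltW ax) ?(ltW xb).
    have h := hg x xab.
    rewrite derive1E derive_val subr_ge0 (le_trans _ (hle _ xab))//.
    have := cauchy_schwarz_complex D (F' x); rewrite [leRHS]mulrC -ler_pdivrMr//.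
    by apply: le_trans; rewrite /p /q le_eqVlt; apply/orP; left; apply/eqP; field.
  - apply: derivable_within_continuous => x; rewrite in_itv/= => xab.
    by have [] := hg x xab.
rewrite /g /= => h.
have e : normc D = p * re D + q * im D.
  have : normc D ^+ 2 = re D ^+ 2 + im D ^+ 2.
    by case: (D) => r s /=; rewrite sqr_sqrtr// addr_ge0 ?sqr_ge0.
  move=> e2; apply: (mulIf D0); rewrite -expr2 e2 /p /q; field; exact: D0.
have eR : re D = re (F b) - re (F a) by rewrite /D; case: (F a); case: (F b).
have eI : im D = im (F b) - im (F a) by rewrite /D; case: (F a); case: (F b).
rewrite e eR eI.
have hg1 y : g y = f y - (p * re (F y) + q * im (F y)) by [].
by move: h; rewrite -/(g a) -/(g b) !hg1; nra.
Qed.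

End Cpow.

(** * Partial sums of the zeta function near its pole *)

Section Zeta.
Variable R : realType.
Variables (rho t : R).
Implicit Types x a b v : R.
Hypothesis rho0 : 0 < rho.
Hypothesis rho1 : rho < 1.
Let K : R := normc ((- rho) +i* t) / rho.
Let w : R[i] := (1 - rho) +i* t.

Lemma normc_w_gt0 : 0 < normc w.
Proof.
rewrite /w /= sqrtr_gt0 ltr_pwDl ?sqr_ge0// exprn_gt0// subr_gt0//.
Qed.

Lemma w_neq0 : w != 0.
Proof. by apply/eqP => h; have := normc_w_gt0; rewrite h normc0 ltxx. Qed.

Lemma K_ge0 : 0 <= K. Proof. by rewrite divr_ge0 ?normc_ge0 ?ltW. Qed.

Lemma is_derive_majorant x : 0 < x ->
  is_derive x 1 (fun v : R => - K * v `^ (- rho))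
    (normc ((- rho) +i* t) * x `^ (- rho - 1)).
Proof.
move=> x0; have h := is_derive1_powR (- rho) x0.
have h2 : is_derive x 1 (fun v : R => - K * v `^ (- rho))
    (- K * (- rho * x `^ (- rho - 1))) by apply: is_deriveZ.
move: h2 => /is_derive_eq; apply.
by rewrite /K; field; rewrite gt_eqF.
Qed.

Lemma cpow_diff a b : 0 < a -> a <= b ->
  normc (cpow b (- rho) t - cpow a (- rho) t) <= K * (a `^ (- rho) - b `^ (- rho)).
Proof.
move=> a0 ab.
apply: le_trans (@mean_value_ineq _ (fun v => cpow v (- rho) t)
  (fun x => ((- rho) +i* t) * cpow x (- rho - 1) t) (fun v => - K * v `^ (- rho))
  (fun x => normc ((- rho) +i* t) * x `^ (- rho - 1)) a b ab _ _ _) _.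
- by move=> x /andP[/(lt_le_trans a0) x0 _]; exact: is_cderive_cpow.
- by move=> x /andP[/(lt_le_trans a0) x0 _]; exact: is_derive_majorant.
- by move=> x _; rewrite normcM normc_cpow.
- by rewrite le_eqVlt; apply/orP; left; apply/eqP; ring.
Qed.

(** With s = rho - i t, so that w = 1 - s: this compares a term b^(-s) of a
    sum with the integral of v^(-s) over [a, b].  The function
    (v - a) v^(-s) - (v^(1-s) - a^(1-s))/(1-s) vanishes at a, and its derivative
    is -s (v - a) v^(-s-1). *)
Lemma cpow_int_diff a b : 0 < a -> a <= b -> b <= a + 1 ->
  normc ((b - a)%:C * cpow b (- rho) t - (cpow b (1 - rho) t - cpow a (1 - rho) t) / w)
   <= K * (a `^ (- rho) - b `^ (- rho)).
Proof.
move=> a0 ab ba.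
pose F v := ((v - a)%:C * cpow v (- rho) t) +
   ((- w^-1) * cpow v (1 - rho) t).
have hF x : a <= x <= b -> is_cderive x F ((x - a)%:C * (((- rho) +i* t) * cpow x (- rho - 1) t)).
  move=> /andP[ax xb]; have x0 := lt_le_trans a0 ax.
  have hk : is_derive x 1 (fun v : R => v - a) 1.
    have h0 := @is_deriveB _ _ _ _ _ _ _ _ _ (is_derive_id x 1) (is_derive_cst a x 1).
    by move: h0; rewrite subr0.
  have h1 := is_cderive_realM hk (is_cderive_cpow (- rho) t x0).
  have h2 := is_cderiveZ (- w^-1) (is_cderive_cpow (1 - rho) t x0).
  have := is_cderiveD h1 h2; congr is_cderive.
  rewrite -/w (_ : 1 - rho - 1 = - rho); last by ring.
  by rewrite (_ : 1%:C = 1)//; field; exact: w_neq0.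
apply: le_trans (_ : normc (F b - F a) <= _).
  rewrite /F subrr (_ : 0%:C = 0)// mul0r add0r le_eqVlt; apply/orP; left; apply/eqP.
  by congr normc; field; exact: w_neq0.
apply: le_trans (@mean_value_ineq _ F _ (fun v => - K * v `^ (- rho))
  (fun x => normc ((- rho) +i* t) * x `^ (- rho - 1)) a b ab hF _ _) _.
- by move=> x /andP[/(lt_le_trans a0) x0 _]; exact: is_derive_majorant.
- move=> x /andP[ax xb]; rewrite !normcM normc_cpow normc_real ger0_norm ?subr_ge0//.
  rewrite ler_piMl ?mulr_ge0 ?normc_ge0 ?powR_ge0//; lra.
- by rewrite le_eqVlt; apply/orP; left; apply/eqP; ring.
Qed.

Lemma cpow_trunc_diff a b : 0 < a -> a <= b -> b <= a + 1 ->
  normc ((cpow b (1 - rho) t - cpow a (1 - rho) t) / w) <= a `^ (- rho).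
Proof.
move=> a0 ab ba; rewrite normcM normcV ler_pdivrMr ?normc_w_gt0// mulrC.
apply: le_trans (@mean_value_ineq _ (fun v => cpow v (1 - rho) t)
  (fun x => w * cpow x (1 - rho - 1) t) (fun v => (normc w * a `^ (- rho)) * v)
  (fun=> (normc w * a `^ (- rho)) * 1) a b ab _ _ _) _.
- by move=> x /andP[/(lt_le_trans a0) x0 _]; exact: is_cderive_cpow.
- move=> x /andP[ax xb]; rewrite mulr1 normcM normc_cpow ler_pM2l ?normc_w_gt0//.
  rewrite (_ : 1 - rho - 1 = - rho); last by ring.
  rewrite !powRN lef_pV2 ?posrE ?powR_gt0 ?(lt_le_trans a0)//.
  by apply: ge0_ler_powR; rewrite ?nnegrE ?(ltW rho0) ?(ltW a0)// (le_trans (ltW a0)).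
- rewrite -mulrBr -{2}[normc w * _]mulr1 ler_wpM2l ?mulr_ge0 ?normc_ge0 ?powR_ge0//; lra.
Qed.

Definition zeta_sum (N : nat) : R[i] := \sum_(1 <= n < N.+1) cpow n%:R (- rho) t.
(** It tends to zeta(s), s = rho - i t, when N grows.  Working with a large
    N instead of the limit avoids any discussion of convergence. *)
Definition zeta_const (N : nat) : R[i] := zeta_sum N - cpow N%:R (1 - rho) t / w.

Lemma zeta_constS N : (0 < N)%N -> normc (zeta_const N.+1 - zeta_const N) <= K * (N%:R `^ (- rho) - N.+1%:R `^ (- rho)).
Proof.
move=> N0; have N0' : (0 : R) < N%:R by rewrite ltr0n.
have := @cpow_int_diff N%:R N.+1%:R N0'; rewrite ler_nat leqnSn -natr1 => /(_ isT).
rewrite lexx => /(_ isT); apply: le_trans; rewrite le_eqVlt; apply/orP; left; apply/eqP.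
congr normc; rewrite /zeta_const /zeta_sum big_nat_recr//= -natr1.
rewrite (_ : (N%:R + 1 - N%:R) = 1 :> R); last by ring.
by rewrite (_ : 1%:C = 1)//; ring.
Qed.

Lemma zeta_const_diff M N : (0 < M)%N -> (M <= N)%N ->
  normc (zeta_const N - zeta_const M) <= K * (M%:R `^ (- rho) - N%:R `^ (- rho)).
Proof.
move=> M0; elim: N => [|N IH]; first by rewrite leqn0 => /eqP M1; rewrite M1 in M0.
rewrite leq_eqVlt => /orP[/eqP <-|MN]; first by rewrite !subrr normc0 mulr0.
have N0 : (0 < N)%N by exact: leq_trans M0 MN.
rewrite (_ : zeta_const N.+1 - zeta_const M = (zeta_const N.+1 - zeta_const N) + (zeta_const N - zeta_const M)); last by ring.
apply: le_trans (le_normcD _ _) _; apply: le_trans (lerD (zeta_constS N0) (IH MN)) _.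
by rewrite le_eqVlt; apply/orP; left; apply/eqP; ring.
Qed.

Lemma zeta_const1 : normc (zeta_const 1 - (1 - w^-1)) = 0.
Proof. by rewrite /zeta_const /zeta_sum big_nat1 !cpow1 mul1r subrr normc0. Qed.

(** The pole of zeta dominates: zeta_const 1 = 1 - w^-1, and the later terms
    move the value by at most K = |s|/rho. *)
Lemma zeta_const_ge N : (0 < N)%N -> (normc w)^-1 - 1 - K <= normc (zeta_const N).
Proof.
move=> N0; have := zeta_const_diff (isT : 0 < 1)%N N0.
have e1 : zeta_const 1 = 1 - w^-1 by apply/eqP; rewrite -subr_eq0; apply/eqP/(eq0_normc zeta_const1).
rewrite e1 powR1 => h.
have := le_normcD (1 - zeta_const N) (zeta_const N - (1 - w^-1)).
rewrite (_ : (1 - zeta_const N) + (zeta_const N - (1 - w^-1)) = w^-1); last by ring.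
rewrite normcV => h2; have := normcB 1 (zeta_const N); rewrite normc1 => h3.
have : K * (1 - N%:R `^ (- rho)) <= K * 1 by rewrite ler_wpM2l ?K_ge0// gerBl powR_ge0.
by move: h h2 h3; lra.
Qed.

Lemma zeta_const_le N : (0 < N)%N -> normc (zeta_const N) <= 1 + (normc w)^-1 + K.
Proof.
move=> N0; have := zeta_const_diff (isT : 0 < 1)%N N0.
have e1 : zeta_const 1 = 1 - w^-1 by apply/eqP; rewrite -subr_eq0; apply/eqP/(eq0_normc zeta_const1).
rewrite e1 powR1 => h.
have := le_normcD (zeta_const N - (1 - w^-1)) (1 - w^-1).
rewrite subrK => h2; have := normcB 1 (w^-1); rewrite normc1 normcV => h3.
have : K * (1 - N%:R `^ (- rho)) <= K * 1 by rewrite ler_wpM2l ?K_ge0// gerBl powR_ge0.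
by move: h h2 h3; lra.
Qed.

(** The range 0 < X < 1, where the sum is empty, is included because the
    induction over the primes of the sieve replaces X by X/p. *)
Lemma zeta_sum_approx N (X : R) : 0 < X -> X <= N%:R ->
  normc (zeta_sum (Num.truncn X) - cpow X (1 - rho) t / w - zeta_const N)
   <= (3 + 2 / normc w + 2 * K) * X `^ (- rho).
Proof.
move=> X0 XN; have w0 := normc_w_gt0; have w0' : 0 < (normc w)^-1 by rewrite invr_gt0.
have N0 : (0 < N)%N by rewrite -(ltr0n R) (lt_le_trans X0).
have [X1|X1] := ltP X 1.
  have -> : Num.truncn X = 0%N.
    by apply/eqP; rewrite truncn_eq ?(ltW X0)// X1.
  rewrite /zeta_sum big_geq// sub0r.
  apply: le_trans (normcB _ _) _; rewrite normcN normcM normcV normc_cpow.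
  have h : X `^ (1 - rho) <= X `^ (- rho).
    by apply: ger_powR; rewrite ?X0 ?(ltW X1)//; lra.
  have h1 : 1 <= X `^ (- rho).
    by rewrite -(powRr0 X); apply: ger_powR; rewrite ?X0 ?(ltW X1)// oppr_le0 ltW.
  have h2 := zeta_const_le N0; have k0 := K_ge0.
  apply: le_trans (_ : X `^ (- rho) * (normc w)^-1 + (1 + (normc w)^-1 + K) * X `^ (- rho) <= _).
    apply: lerD; first by rewrite ler_wpM2r// ltW.
    apply: le_trans h2 _; rewrite ler_peMr// !addr_ge0// ltW//.
  nra.
set n := Num.truncn X.
have n1 : (0 < n)%N by rewrite truncn_gt0.
have /andP[nX Xn] := truncn_itv (le_trans ler01 X1).
have n0' : (0 : R) < n%:R by rewrite ltr0n.
rewrite (_ : zeta_sum n - _ - _ = - (zeta_const N - zeta_const n) - (cpow X (1 - rho) t - cpow n%:R (1 - rho) t) / w); last first.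
  by rewrite /zeta_const; ring.
apply: le_trans (normcB _ _) _; rewrite normcN.
have nN : (n <= N)%N by rewrite -(ler_nat R) (le_trans nX).
have h1 := zeta_const_diff n1 nN.
have h2 := @cpow_trunc_diff n%:R X n0' nX.
rewrite natr1 (ltW Xn) in h2; have {}h2 := h2 isT.
have h3 : n%:R `^ (- rho) <= 2 * X `^ (- rho).
  have hX : X <= 2 * n%:R.
    rewrite (le_trans (ltW Xn))// -natr1.
    have : (1:R) <= n%:R by rewrite ler1n.
    by lra.
  rewrite !powRN ler_pdivlMr ?powR_gt0// mulrC ler_pdivrMr ?powR_gt0//.
  apply: le_trans (_ : (2 * n%:R) `^ rho <= _).
    by apply: ge0_ler_powR; rewrite ?nnegrE ?(ltW rho0) ?(ltW X0)// mulr_ge0.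
  rewrite powRM ?ler0n// ler_wpM2r ?powR_ge0//.
  by apply: ler1_powR; [rewrite ler1n|exact: ltW].
have k0 := K_ge0.
have := powR_ge0 (N%:R : R) (- rho).
have := powR_ge0 X (- rho). nra.
Qed.

End Zeta.

(** * The error term of a sieve and its Dirichlet series *)

Lemma sum_multiples (K : nmodType) (F : nat -> K) (p N : nat) : (0 < p)%N ->
  \sum_(1 <= n < N.+1 | (p %| n)%N) F n =
  \sum_(1 <= m < (N %/ p).+1) F (p * m)%N.
Proof.
move=> p0; elim: N => [|N IH]; first by rewrite div0n !big_geq.
rewrite big_mkcond big_nat_recr//= -big_mkcond/= IH divnS//.
case: ifP => pN; last by rewrite addr0.
rewrite add1n [in RHS]big_nat_recr//=; congr (_ + F _).
by rewrite -{1}(divnK pN) divnS// pN mulnC.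
Qed.

Section Sieve.

(** The ring K is a parameter so that the weight can be used both in real sums
    and in complex Dirichlet sums. *)
Definition sieve_weight (K : comPzRingType) (g : nat -> K) (W : seq nat) (n : nat) : K :=
  \prod_(p <- W | (p %| n)%N) (1 - g p).

(** Adding one prime to the sieve is a recursion (of Buchstab type) which
    holds for every completely multiplicative twist phi.  With phi = 1 it gives
    the sieve error, with phi(n) = n^(-s) its Dirichlet series. *)
Lemma sum_sieve_weight_cons (K : comPzRingType) (g phi : nat -> K) p W N :
  all prime (p :: W) -> uniq (p :: W) ->
  (forall m, (0 < m)%N -> phi (p * m)%N = phi p * phi m) ->
  \sum_(1 <= n < N.+1) sieve_weight g (p :: W) n * phi n =
  \sum_(1 <= n < N.+1) sieve_weight g W n * phi n
  - g p * phi p * \sum_(1 <= m < (N %/ p).+1) sieve_weight g W m * phi m.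
Proof.
move=> /= /andP[pp Wp] /andP[pW _] hphi.
have e n : sieve_weight g (p :: W) n * phi n = sieve_weight g W n * phi n -
    (if (p %| n)%N then g p * (sieve_weight g W n * phi n) else 0).
  by rewrite /sieve_weight big_cons; case: ifP => _; ring.
rewrite (eq_bigr _ (fun n _ => e n)) sumrB -big_mkcond /= sum_multiples ?prime_gt0//.
congr (_ - _); rewrite big_distrr /=; apply: eq_big_nat => m /andP[m0 _].
rewrite hphi// (_ : sieve_weight g W (p * m)%N = sieve_weight g W m); first by ring.
rewrite /sieve_weight big_seq_cond [RHS]big_seq_cond; apply: eq_bigl => r.
case rW: (r \in W) => //=; have rp := allP Wp r rW.
rewrite Euclid_dvdM// dvdn_prime2//; case: eqP => // rep.
by rewrite -rep rW in pW.
Qed.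

Variable R : realType.
Implicit Types (g : nat -> R) (W : seq nat) (y : R).

Definition sieve_mean g W : R := \prod_(p <- W) (1 - g p / p%:R).
Definition sieve_error g W y : R :=
  \sum_(1 <= n < (Num.truncn y).+1) sieve_weight g W n - sieve_mean g W * y.

Lemma truncn_div y p : 0 <= y -> (0 < p)%N ->
  Num.truncn (y / p%:R) = (Num.truncn y %/ p)%N.
Proof.
move=> y0 p0; have p0' : (0 : R) < p%:R by rewrite ltr0n.
apply/truncn_def; have /andP[h1 h2] := truncn_itv y0.
rewrite ler_pdivlMr// ltr_pdivrMr// -!natrM; apply/andP; split.
  by apply: le_trans h1; rewrite ler_nat leq_divM.
by apply: lt_le_trans h2 _; rewrite ler_nat ltn_ceil.
Qed.

Lemma sieve_error_nil g y : sieve_error g [::] y = (Num.truncn y)%:R - y.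
Proof.
rewrite /sieve_error /sieve_mean big_nil mul1r; congr (_ - _).
rewrite (eq_bigr (fun=> 1)); last by move=> n _; rewrite /sieve_weight big_nil.
by rewrite big_const_nat subn1 /= iter_addr_0.
Qed.

Lemma sieve_error_cons g p W y : all prime (p :: W) -> uniq (p :: W) -> 0 <= y ->
  sieve_error g (p :: W) y = sieve_error g W y - g p * sieve_error g W (y / p%:R).
Proof.
move=> ap up y0; have pp : prime p by case/andP: ap.
have := @sum_sieve_weight_cons R g (fun=> 1) p W (Num.truncn y) ap up.
move=> /(_ (fun m _ => esym (mulr1 1))) /= h.
rewrite /sieve_error truncn_div ?prime_gt0//.
transitivity (\sum_(1 <= n < (Num.truncn y).+1) sieve_weight g (p :: W) n * 1 - sieve_mean g (p :: W) * y).
  by congr (_ - _); apply: eq_bigr => n _; rewrite mulr1.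
rewrite h /sieve_mean big_cons.
have eW M : \sum_(1 <= n < M) sieve_weight g W n * 1 = \sum_(1 <= n < M) sieve_weight g W n.
  by apply: eq_bigr => n _; rewrite mulr1.
rewrite !eW; ring.
Qed.

(** Rankin's bound.  Without primes the error is the fractional part of y, at
    most y^(1 - sg); the recursion evaluates it at y/p, which costs the factor
    p^(sg - 1). *)
Lemma sieve_error_bound g W y (sg : R) : all prime W -> uniq W ->
  (forall p, p \in W -> 0 <= g p) -> 0 <= sg <= 1 -> 0 < y ->
  `|sieve_error g W y| <= y `^ (1 - sg) * \prod_(p <- W) (1 + g p * p%:R `^ (sg - 1)).
Proof.
move=> + + + /andP[sg0 sg1]; elim: W y => [|p W IH] y ap up hg y0.
  rewrite sieve_error_nil big_nil mulr1 distrC.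
  have /andP[h1 h2] := truncn_itv (ltW y0).
  rewrite ger0_norm ?subr_ge0//.
  have [y1|y1] := ltP y 1.
    apply: le_trans (_ : y <= _); first by rewrite gerBl.
    by apply: ger1_powR; rewrite ?y0 ?(ltW y1)//; lra.
  apply: le_trans (_ : 1 <= _); first by rewrite -natr1 in h2; lra.
  by rewrite -[leLHS](powRr0 y); apply: ler_powR => //; rewrite subr_ge0.
have /andP[pp Wp] := ap; have /andP[_ uW] := up.
have p0 : (0 : R) < p%:R by rewrite ltr0n prime_gt0.
rewrite sieve_error_cons ?(ltW y0)// big_cons.
have hg0 r : r \in W -> 0 <= g r by move=> rW; apply: hg; rewrite inE rW orbT.
have gp : 0 <= g p by apply: hg; rewrite mem_head.
apply: le_trans (ler_normB _ _) _; rewrite normrM (ger0_norm gp).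
have h1 := IH y Wp uW hg0 y0.
have h2 := IH (y / p%:R) Wp uW hg0 (divr_gt0 y0 p0).
apply: le_trans (lerD h1 (ler_wpM2l gp h2)) _.
rewrite (powRM _ (ltW y0)) ?(ltW p0) ?invr_ge0 ?(ltW p0)// -(powR_inv1 (ltW p0)) -powRrM.
rewrite (_ : -1 * (1 - sg) = sg - 1); last by ring.
by rewrite le_eqVlt; apply/orP; left; apply/eqP; ring.
Qed.

Section Dirichlet.
Variables (rho t : R).
Hypothesis rho0 : 0 < rho.
Hypothesis rho1 : rho < 1.
Let w : R[i] := (1 - rho) +i* t.
Let s : R[i] := (- rho) +i* t.
Let gC g p : R[i] := (g p)%:C.

Definition sieve_euler_product g W : R[i] := \prod_(p <- W) (1 - gC g p * cpow p%:R (- rho) t).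
Definition sieve_dirichlet_sum g W (X : R) : R[i] :=
  \sum_(1 <= n < (Num.truncn X).+1) sieve_weight (gC g) W n * cpow n%:R (- rho) t.

Lemma cpow_scale (X : R) p : 0 < X -> (0 < p)%N ->
  cpow p%:R (- rho) t * cpow (X / p%:R) (1 - rho) t = (p%:R^-1)%:C * cpow X (1 - rho) t.
Proof.
move=> X0 p0; have p0' : (0 : R) < p%:R by rewrite ltr0n.
have -> : cpow X (1 - rho) t = cpow p%:R (1 - rho) t * cpow (X / p%:R) (1 - rho) t.
  by rewrite -cpowM ?divr_gt0// mulrCA divff ?mulr1// gt_eqF.
have -> : cpow p%:R (1 - rho) t = (p%:R)%:C * cpow p%:R (- rho) t.
  rewrite -{1}[t]add0r cpowD//; congr (_ * _); apply/eqP.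
  by rewrite eq_complex /= powRr1 ?(ltW p0')// mul0r cos0 sin0 mulr1 mulr0 !eqxx.
by rewrite !mulrA -rmorphM mulVf ?gt_eqF// rmorph1 mul1r.
Qed.

(** The Dirichlet series of the sieve weight is zeta(s) times the Euler
    product; its pole at s = 1 produces the term with sieve_mean. *)
Lemma sieve_dirichlet_sum_approx g W : all prime W -> uniq W ->
  exists C : R, 0 <= C /\ forall (N : nat) (X : R), 0 < X -> X <= N%:R ->
    normc (sieve_dirichlet_sum g W X - (sieve_mean g W)%:C * cpow X (1 - rho) t / w - zeta_const rho t N * sieve_euler_product g W)
      <= C * X `^ (- rho).
Proof.
elim: W => [|p W IH] ap up.
  exists (3 + 2 / normc w + 2 * (normc s / rho)); split.
    by rewrite !addr_ge0// ?mulr_ge0 ?invr_ge0 ?normc_ge0// ltW.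
  move=> N X X0 XN; have := zeta_sum_approx t rho0 rho1 X0 XN.
  apply: le_trans; rewrite le_eqVlt; apply/orP; left; apply/eqP; congr normc.
  rewrite /sieve_dirichlet_sum /sieve_euler_product /sieve_mean !big_nil mulr1 (_ : 1%:C = 1)// mul1r; congr (_ - _ - _).
  by apply: eq_bigr => n _; rewrite /sieve_weight big_nil mul1r.
have /andP[pp Wp] := ap; have /andP[_ uW] := up.
have [C [C0 hC]] := IH Wp uW.
have p0 : (0 : R) < p%:R by rewrite ltr0n prime_gt0.
exists (C * (1 + `|g p|)); split; first by rewrite mulr_ge0// addr_ge0.
move=> N X X0 XN.
have h1 := hC N X X0 XN.
have X0p : 0 < X / p%:R by rewrite divr_gt0.
have Xp : X / p%:R <= N%:R.
  apply: le_trans XN; rewrite ler_pdivrMr// ler_peMr ?(ltW X0)//.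
  by rewrite ler1n prime_gt0.
have h2 := hC N _ X0p Xp.
have e : sieve_dirichlet_sum g (p :: W) X = sieve_dirichlet_sum g W X - gC g p * cpow p%:R (- rho) t * sieve_dirichlet_sum g W (X / p%:R).
  rewrite /sieve_dirichlet_sum truncn_div ?ltW ?prime_gt0//; apply: sum_sieve_weight_cons => // m m0.
  by rewrite natrM cpowM// ltr0n.
set A := sieve_dirichlet_sum g W X - _ - _ in h1; set B := sieve_dirichlet_sum g W (X / p%:R) - _ - _ in h2.
rewrite [X in normc X](_ : _ = A - gC g p * cpow p%:R (- rho) t * B).
  apply: le_trans (normcB _ _) _; rewrite !normcM normc_real normc_cpow.
  have h3 : `|g p| * p%:R `^ (- rho) * normc B <= `|g p| * (C * X `^ (- rho)).
    rewrite -mulrA ler_wpM2l//.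
    apply: le_trans (ler_wpM2l (powR_ge0 _ _) h2) _.
    rewrite mulrCA ler_wpM2l// -powRM ?(ltW X0) ?(ltW X0p) ?(ltW p0)// mulrCA divff ?mulr1// gt_eqF//.
  by rewrite (le_trans (lerD h1 h3))// le_eqVlt; apply/orP; left; apply/eqP; ring.
rewrite e /A /B.
have e2 := cpow_scale X0 (prime_gt0 pp).
have eg : (sieve_mean g (p :: W))%:C = (sieve_mean g W)%:C - gC g p * (p%:R^-1)%:C * (sieve_mean g W)%:C.
  by rewrite /sieve_mean big_cons /gC -!rmorphM -rmorphB; congr (_%:C); ring.
have eG : sieve_euler_product g (p :: W) = sieve_euler_product g W - gC g p * cpow p%:R (- rho) t * sieve_euler_product g W.
  by rewrite /sieve_euler_product big_cons; ring.
rewrite eg eG.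
have -> : gC g p * cpow p%:R (- rho) t *
   (sieve_dirichlet_sum g W (X / p%:R) - (sieve_mean g W)%:C * cpow (X / p%:R) (1 - rho) t / w - zeta_const rho t N * sieve_euler_product g W)
  = gC g p * cpow p%:R (- rho) t * sieve_dirichlet_sum g W (X / p%:R) -
    gC g p * (sieve_mean g W)%:C * (cpow p%:R (- rho) t * cpow (X / p%:R) (1 - rho) t) / w -
    gC g p * cpow p%:R (- rho) t * (zeta_const rho t N * sieve_euler_product g W) by ring.
rewrite e2; ring.
Qed.

Lemma abel_sum (a phi : nat -> R[i]) N :
  \sum_(1 <= n < N.+1) a n * phi n =
  \sum_(1 <= n < N.+1) (\sum_(1 <= m < n.+1) a m) * (phi n - phi n.+1)
  + (\sum_(1 <= m < N.+1) a m) * phi N.+1.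
Proof.
elim: N => [|N IH]; first by rewrite !big_geq// mul0r addr0.
rewrite big_nat_recr//= IH [in RHS]big_nat_recr//=.
have -> : \sum_(1 <= m < N.+2) a m = \sum_(1 <= m < N.+1) a m + a N.+1.
  by rewrite big_nat_recr.
ring.
Qed.

Lemma sieve_weight_real g W n : sieve_weight (gC g) W n = (sieve_weight g W n)%:C.
Proof.
rewrite /sieve_weight rmorph_prod; apply: eq_bigr => p _.
by rewrite rmorphB.
Qed.

(** The Dirichlet sum of sieve_weight - sieve_mean has no main term left, and
    tends to zeta(s) (G(s) - sieve_mean); summation by parts expresses it through
    the sieve error. *)
Lemma abel_bound g W : all prime W -> uniq W ->
  (forall p, p \in W -> 0 <= g p) ->
  exists C : R, forall N, (0 < N)%N ->
  ((normc w)^-1 - 1 - normc s / rho) * normc (sieve_euler_product g W - (sieve_mean g W)%:C) <=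
  \sum_(1 <= n < N.+1) `|sieve_error g W n%:R| * (normc s / rho * (n%:R `^ (- rho) - n.+1%:R `^ (- rho)))
  + C * N%:R `^ (- rho).
Proof.
move=> ap up hg.
have [C1 [C10 h1]] := sieve_dirichlet_sum_approx g ap up.
have [C2 [C20 h2]] := @sieve_dirichlet_sum_approx g [::] isT isT.
pose C3 := \prod_(p <- W) (1 + g p * p%:R `^ (1 - 1)).
exists (C1 + `|sieve_mean g W| * C2 + C3) => N N0.
have N0' : (0 : R) < N%:R by rewrite ltr0n.
have {}h1 := h1 N _ N0' (lexx _).
have {}h2 := h2 N _ N0' (lexx _).
have h3 : `|sieve_error g W N%:R| <= C3.
  have := @sieve_error_bound g W N%:R 1 ap up hg; rewrite ler01 lexx => /(_ isT N0').
  by rewrite /C3 subrr powRr0 mul1r.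
set S := \sum_(1 <= n < N.+1) `|_| * _.
have hD : sieve_dirichlet_sum g W N%:R - (sieve_mean g W)%:C * sieve_dirichlet_sum g [::] N%:R =
   \sum_(1 <= n < N.+1) (sieve_error g W n%:R)%:C * (cpow n%:R (- rho) t - cpow n.+1%:R (- rho) t)
   + (sieve_error g W N%:R)%:C * cpow N.+1%:R (- rho) t.
  have eE n : (sieve_error g W n%:R)%:C = \sum_(1 <= m < n.+1) ((sieve_weight g W m)%:C - (sieve_mean g W)%:C).
    rewrite sumrB /sieve_error rmorphB natrK rmorph_sum; congr (_ - _).
    rewrite big_const_nat subn1 /= iter_addr_0 rmorphM.
    by rewrite rmorph_nat mulr_natr.
  under eq_bigr do rewrite eE.
  rewrite eE -abel_sum /sieve_dirichlet_sum natrK.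
  rewrite big_distrr /= -sumrB; apply: eq_bigr => n _.
  by rewrite sieve_weight_real /sieve_weight big_nil; ring.
have hD2 : normc (sieve_dirichlet_sum g W N%:R - (sieve_mean g W)%:C * sieve_dirichlet_sum g [::] N%:R) <= S + C3 * N%:R `^ (- rho).
  rewrite hD; apply: le_trans (le_normcD _ _) _; apply: lerD.
    apply: le_trans (normc_sum _ _ _) _; rewrite /S big_nat_cond [leRHS]big_nat_cond.
    apply: ler_sum => n /andP[/andP[n0 _] _]; rewrite normcM normc_real ler_wpM2l//.
    have n0' : (0 : R) < n%:R by rewrite ltr0n.
    have := @cpow_diff _ rho t rho0 n%:R n.+1%:R n0'.
    rewrite ler_nat leqnSn -(normcN (_ - _)) opprB; exact.
  rewrite normcM normc_real normc_cpow ler_pM// ?powR_ge0//.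
  rewrite !powRN lef_pV2 ?posrE ?powR_gt0//.
  by apply: ge0_ler_powR; rewrite ?nnegrE ?ltW// ltr_nat.
have hz := zeta_const_ge t rho0 rho1 N0.
have nn := normc_ge0 (sieve_euler_product g W - (sieve_mean g W)%:C).
apply: le_trans (ler_wpM2r nn hz) _; rewrite -normcM.
set A := sieve_dirichlet_sum g W N%:R - _ - _ in h1; set B := sieve_dirichlet_sum g [::] N%:R - _ - _ in h2.
have -> : zeta_const rho t N * (sieve_euler_product g W - (sieve_mean g W)%:C) =
   (sieve_dirichlet_sum g W N%:R - (sieve_mean g W)%:C * sieve_dirichlet_sum g [::] N%:R) - A + (sieve_mean g W)%:C * B.
  rewrite /A /B {1}/sieve_mean /sieve_euler_product big_nil.
  rewrite [in sieve_mean g [::]]/sieve_mean big_nil (_ : 1%:C = 1)//; ring.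
apply: le_trans (le_normcD _ _) _; rewrite normcM normc_real.
apply: le_trans (lerD (normcB _ _) (lexx _)) _.
have := ler_wpM2l (normr_ge0 (sieve_mean g W)) h2.
move: h1 hD2; set u1 := normc A; set u2 := normc B; set u3 := normc (_ - _).
set u4 := `|sieve_mean g W|; set u5 := _ `^ _; lra.
Qed.

End Dirichlet.
End Sieve.

(** * The sieve error cannot be small everywhere *)

Section ComplexNorm.
Variable R : realType.

Lemma normc_le_abs (a b : R) : normc (a +i* b) <= `|a| + `|b|.
Proof.
rewrite /= -(ler_pXn2r (isT : (0 < 2)%N)) ?nnegrE ?sqrtr_ge0 ?addr_ge0//.
rewrite sqr_sqrtr ?addr_ge0 ?sqr_ge0//.
have := normr_ge0 a; have := normr_ge0 b.
rewrite -(real_normK (num_real a)) -(real_normK (num_real b)); nra.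
Qed.

Lemma Re_le_normc (z : R[i]) : re z <= normc z.
Proof.
have := cauchy_schwarz_complex z 1; rewrite normc1 mulr1 /= mulr1 mulr0 addr0; exact.
Qed.

Lemma normc_prod (I : Type) (s : seq I) (F : I -> R[i]) :
  normc (\prod_(i <- s) F i) = \prod_(i <- s) normc (F i).
Proof. exact: (big_morph _ (@normcM R) (normc1 R)). Qed.

Lemma expR_le_1Dx_small (r : R) : 0 <= r -> r <= 1 / 200 ->
  expR (99 / 100 * r) <= 1 + 199 / 200 * r.
Proof.
move=> r0 r1.
have [c hc] : exists c, c = 199 / 200 * r by exists (199 / 200 * r).
have c0 : 0 <= c by lra.
have cr : c <= r by lra.
have c1 : 0 <= c <= 1 by rewrite c0 /=; lra.
rewrite -hc; apply: le_trans (expR_subr_sqr_le c1); rewrite ler_expR.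
have : c ^+ 2 <= r * (1 / 200) by rewrite expr2 ler_pM //; lra.
by lra.
Qed.

End ComplexNorm.

Section Oscillation.
Variable R : realType.
Variables (W : seq nat) (g : nat -> R) (lP sg Lam : R).
Hypothesis Wp : all prime W.
Hypothesis Wu : uniq W.
Hypothesis hg : forall p, p \in W -> 0 <= g p <= 1.
Hypothesis hlo : forall p, p \in W -> lP <= ln (p%:R : R) <= 21 / 20 * lP.
Hypothesis hLam : \sum_(p <- W) g p * p%:R `^ (sg - 1) = Lam.
Hypothesis hlP : 400 <= lP.
Let X : R := sg * lP.
Hypothesis hX4 : 4 <= X.
Hypothesis hX3 : X <= lP / 3.
(* 41/40 is the middle of the window [1, 21/20], in units of lP. *)
Let t : R := pi / (41 / 40 * lP).
Let rho : R := 1 - sg.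
Let w : R[i] := (1 - rho) +i* t.
Let s : R[i] := (- rho) +i* t.

Let lP0 : 0 < lP. Proof. by move: hlP; lra. Qed.
Let sgE : sg = X / lP. Proof. by rewrite /X mulfK// gt_eqF. Qed.
Let X0 : 0 < X. Proof. by apply: lt_le_trans hX4. Qed.
Let sg0 : 0 < sg. Proof. by rewrite sgE divr_gt0. Qed.
Let sg3 : sg <= 1 / 3.
Proof. by rewrite sgE ler_pdivrMr//; move: hX3; lra. Qed.
Let rho0 : 0 < rho. Proof. by rewrite /rho; have := sg3; lra. Qed.
Let rho1 : rho < 1. Proof. by rewrite /rho; have := sg0; lra. Qed.
Let t0 : 0 < t. Proof. by rewrite /t divr_gt0 ?pi_gt0// mulr_gt0. Qed.
Let t4 : t <= 4 / lP.
Proof.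
have pi4 : pi < 4 :> R by have := @pihalf_lt2 R; lra.
rewrite /t ler_pdivrMr; last by rewrite mulr_gt0//; lra.
rewrite (_ : 4 / lP * (41 / 40 * lP) = 41 / 10); last by field; rewrite gt_eqF.
by move: pi4; lra.
Qed.
Let t_le_sg : t <= sg.
Proof. by apply: le_trans t4 _; rewrite sgE ler_pM2r// invr_gt0. Qed.
Let tsmall : t <= 1 / 100.
Proof. by apply: le_trans t4 _; rewrite ler_pdivrMr//; move: hlP; lra. Qed.

Let W_gt0 p : p \in W -> (0 : R) < p%:R.
Proof. by move=> pW; rewrite ltr0n prime_gt0// (allP Wp). Qed.

Let Lam0 : 0 <= Lam.
Proof.
rewrite -hLam big_seq sumr_ge0// => p pW.
by have /andP[h _] := hg pW; rewrite mulr_ge0// powR_ge0.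
Qed.

(** On the window t ln p is within pi/41 of pi, so each factor is about
    1 + g_p p^(sg - 1) instead of 1 - g_p p^(sg - 1). *)
Lemma sieve_euler_product_ge : expR (99 / 100 * Lam) <= normc (sieve_euler_product rho t g W).
Proof.
rewrite /sieve_euler_product normc_prod -hLam big_distrr expR_sum big_seq [leRHS]big_seq.
apply: ler_prod => p pW; rewrite expR_ge0 andTb.
have p0 := W_gt0 pW; have /andP[g0 g1] := hg pW; have /andP[l1 l2] := hlo pW.
set r := g p * _.
have r0 : 0 <= r by rewrite mulr_ge0// powR_ge0.
have r1 : r <= 1 / 200.
  apply: le_trans (_ : 1 * p%:R `^ (sg - 1) <= _); first by rewrite ler_wpM2r// powR_ge0.
  rewrite mul1r powRE//.
  have hy : 200 <= (1 - sg) * ln p%:R.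
    apply: le_trans (_ : 2 / 3 * 400 <= _); first by lra.
    by apply: ler_pM; [lra|lra|move: sg3; lra|apply: le_trans l1].
  have h1 := expR_ge1Dx ((1 - sg) * ln p%:R).
  have -> : (sg - 1) * ln p%:R = - ((1 - sg) * ln p%:R) by ring.
  rewrite expRN -[leLHS]mul1r ler_pdivrMr ?expR_gt0//.
  by move: hy h1; lra.
apply: le_trans (Re_le_normc _).
have hcos : 199 / 200 <= - cos (t * ln p%:R).
  have -> : - cos (t * ln p%:R) = cos (t * ln p%:R - pi).
    by rewrite -[in LHS](subrK pi (t * ln p%:R)) cosDpi opprK.
  apply: le_trans (cos_lower _).
  set th := t * ln p%:R - pi.
  have hpi : pi < 4 :> R by have := @pihalf_lt2 R; lra.
  have hpi0 := pi_gt0 R.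
  have eth : th = pi * (ln p%:R / (41 / 40 * lP) - 1).
    by rewrite /th /t; field; rewrite gt_eqF.
  set q := ln p%:R / (41 / 40 * lP) in eth.
  have q1 : 40 / 41 <= q by rewrite /q ler_pdivlMr; [lra|rewrite mulr_gt0//; lra].
  have q2 : q <= 42 / 41 by rewrite /q ler_pdivrMr; [lra|rewrite mulr_gt0//; lra].
  have a1 : - (1 / 10) <= th by rewrite eth; nra.
  have a2 : th <= 1 / 10 by rewrite eth; nra.
  have : th ^+ 2 <= 1 / 100 by nra.
  by lra.
have -> : re (1 - (g p)%:C * cpow p%:R (- rho) t) = 1 + r * - cos (t * ln p%:R).
  rewrite /cpow /= mul0r subr0 /r /rho (_ : - (1 - sg) = sg - 1); last by ring.
  by ring.
apply: le_trans (_ : 1 + 199 / 200 * r <= _); last first.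
  by rewrite lerD2l mulrC ler_wpM2l.
exact: expR_le_1Dx_small.
Qed.

Lemma sieve_mean01 : 0 <= sieve_mean g W <= 1.
Proof.
have h p : p \in W -> 0 <= 1 - g p / p%:R <= 1.
  move=> pW; have p0 := W_gt0 pW; have /andP[g0 g1] := hg pW.
  have p1 : (1 : R) <= p%:R by rewrite ler1n -(ltr0n R).
  by rewrite subr_ge0 ler_pdivrMr// mul1r (le_trans g1)//= gerBl divr_ge0// ltW.
rewrite /sieve_mean big_seq; elim/big_ind: _ => [|x y /andP[x0 x1] /andP[y0 y1]|p /h//].
  by rewrite ler01 lexx.
by rewrite mulr_ge0// mulr_ile1.
Qed.

(** The product in Rankin's bound at exponent sg + th is controlled by the
    tilted sum Lam at exponent sg. *)
Lemma sieve_majorant_le (th : R) (B : R) :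
  (forall p, p \in W -> p%:R `^ th <= B) ->
  \prod_(p <- W) (1 + g p * p%:R `^ (sg + th - 1)) <= expR (B * Lam).
Proof.
move=> hB; apply: le_trans (prod_1D_le_expR _) _.
  by move=> p pW; have /andP[g0 _] := hg pW; rewrite mulr_ge0// powR_ge0.
rewrite ler_expR -hLam big_distrr big_seq [leRHS]big_seq; apply: ler_sum => p pW.
have p0 := W_gt0 pW; have /andP[g0 g1] := hg pW.
rewrite (_ : sg + th - 1 = th + (sg - 1)); last by ring.
rewrite powRD ?(gt_eqF p0) ?implybT//= mulrCA ler_wpM2r ?hB// mulr_ge0 ?powR_ge0//.
Qed.

Let norms : normc s <= 2.
Proof.
apply: le_trans (normc_le_abs _ _) _; rewrite normrN !ger0_norm ?ltW//.
by have := rho1; have := tsmall; lra.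
Qed.

Lemma abel_weight_le n : (0 < n)%N ->
  normc s / rho * (n%:R `^ (- rho) - n.+1%:R `^ (- rho)) <= 2 * n%:R `^ (sg - 2).
Proof.
move=> n0.
apply: le_trans (ler_wpM2l _ (powR_diff_le rho0 n0)) _.
  by rewrite divr_ge0 ?normc_ge0// ltW.
rewrite mulrA divfK ?gt_eqF// (_ : - rho - 1 = sg - 2); last by rewrite /rho; ring.
by rewrite ler_wpM2r ?powR_ge0.
Qed.

Let hg0 p : p \in W -> 0 <= g p.
Proof. by move=> /hg/andP[]. Qed.

(** Rankin's bound at exponent sg + th: th < 0 serves for small n, th > 0 for
    large n. *)
Lemma abel_term_le (th B : R) n :
  (forall p, p \in W -> p%:R `^ th <= B) -> 0 <= sg + th <= 1 -> (0 < n)%N ->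
  `|sieve_error g W n%:R| * (normc s / rho * (n%:R `^ (- rho) - n.+1%:R `^ (- rho))) <=
  2 * expR (B * Lam) * n%:R `^ (- 1 - th).
Proof.
move=> hB hth n0.
have n0' : (0 : R) < n%:R by rewrite ltr0n.
have h1 := sieve_error_bound Wp Wu hg0 hth n0'.
have h2 := abel_weight_le n0.
apply: le_trans (_ : (n%:R `^ (1 - (sg + th)) * expR (B * Lam)) * (2 * n%:R `^ (sg - 2)) <= _).
  apply: ler_pM => //.
    rewrite mulr_ge0 ?divr_ge0 ?normc_ge0 ?(ltW rho0)// subr_ge0 !powRN.
    rewrite lef_pV2 ?posrE ?powR_gt0// ?ltr0n//.
    by apply: ge0_ler_powR; rewrite ?nnegrE ?ler0n ?(ltW rho0)// ler_nat.
  by apply: le_trans h1 _; rewrite ler_wpM2l ?powR_ge0// sieve_majorant_le.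
rewrite le_eqVlt; apply/orP; left; apply/eqP.
rewrite (_ : - 1 - th = (1 - (sg + th)) + (sg - 2)); last by ring.
by rewrite [in RHS]powRD ?(gt_eqF n0') ?implybT//; ring.
Qed.

(** If |E(n)| <= d1 n on the middle range, then the three ranges of n
    contribute at most 10 lP e98, 4 d1 exp((7/5) Lam X)/sg and 7 lP e98 to the
    bound of abel_bound, with e98 = exp((197/200) Lam), whereas the left-hand
    side is of size exp((99/100) Lam)/|w| and |w| <= 2 sg. *)
Lemma sieve_error_not_small (d1 : R) (M : nat) :
  340 * X + 50 <= expR (1 / 200 * Lam) ->
  0 <= d1 ->
  expR (7 / 5 * Lam * lP) <= M%:R <= 2 * expR (7 / 5 * Lam * lP) ->
  (forall n : nat, expR (4 / 5 * Lam * lP) <= n%:R -> (n <= M)%N ->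
    `|sieve_error g W n%:R| <= d1 * n%:R) ->
  1 <= 16 * d1 * expR (7 / 5 * Lam * X).
Proof.
move=> hexp d10 /andP[M1 M2] hE.
set Y := expR (4 / 5 * Lam * lP) in hE.
set e98 := expR (197 / 200 * Lam).
have e98_1 : 1 <= e98 by rewrite -expR0 ler_expR; move: Lam0; lra.
have Y1 : 1 <= Y by rewrite -expR0 ler_expR !mulr_ge0// ?(ltW lP0)//; lra.
set m1 := Num.truncn Y.
have m10 : (0 < m1)%N by rewrite truncn_gt0.
have /andP[m1Y Ym1] := truncn_itv (le_trans ler01 Y1).
have m1M : (m1 <= M)%N.
  rewrite -(ler_nat R); apply: le_trans m1Y _; apply: le_trans M1.
  by rewrite ler_expR ler_wpM2r ?(ltW lP0)// ler_wpM2r//; lra.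
have M0 : (0 < M)%N := leq_trans m10 m1M.
have [C hC] := abel_bound t rho0 rho1 Wp Wu hg0.
(* The remainder C N^(-rho) of abel_bound is at most 1 since rho >= 1/2. *)
pose N := (M + (Num.truncn (C ^+ 2)).+1)%N.
have MN : (M <= N)%N by rewrite leq_addr.
have N0 : (0 < N)%N := leq_trans M0 MN.
have N0' : (0 : R) < N%:R by rewrite ltr0n.
have CN : C * N%:R `^ (- rho) <= 1.
  apply: le_trans (_ : `|C| * N%:R `^ (- rho) <= _).
    by rewrite ler_wpM2r ?powR_ge0// ler_norm.
  rewrite powRN ler_pdivrMr ?powR_gt0// mul1r.
  apply: le_trans (_ : N%:R `^ (2^-1) <= _); last first.
    by apply: ler_powR; rewrite ?ler1n// /rho; have := sg3; lra.
  rewrite powR12_sqrt ?(ltW N0')// -sqrtr_sqr ler_wsqrtr//.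
  apply: le_trans (ltW (truncnS_gt _)) _.
  by rewrite ler_nat /N leq_addl.
have {hC} := hC N N0.
rewrite -/w -/s.
pose F n := `|sieve_error g W n%:R| *
   (normc s / rho * (n%:R `^ (- rho) - n.+1%:R `^ (- rho))).
rewrite -[X in _ <= X + _]/(\sum_(1 <= n < N.+1) F n).
have eS : \sum_(1 <= n < N.+1) F n = \sum_(1 <= n < m1.+1) F n +
   \sum_(m1.+1 <= n < M.+1) F n + \sum_(M.+1 <= n < N.+1) F n.
  by rewrite -!big_cat_nat//.
have hp4 (x : R) : expR x = expR (x / 4) ^+ 4.
  by rewrite -expRM_natl; congr expR; field.
(* Small n: exponent sg - 1/(5 lP), where exp(-1/5) <= 33/40 and
   33/40 + 4/25 = 197/200. *)
have S1 : \sum_(1 <= n < m1.+1) F n <= 10 * lP * e98.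
  pose th := - (1 / 5 / lP).
  have thp : 0 < 1 / 5 / lP by rewrite divr_gt0.
  have hB p : p \in W -> p%:R `^ th <= 33 / 40.
    move=> pW; have p0 := W_gt0 pW; have /andP[l1 l2] := hlo pW.
    rewrite powRE// /th mulNr expRN.
    apply: le_trans (_ : (expR (1 / 5))^-1 <= _).
      rewrite lef_pV2 ?posrE ?expR_gt0// ler_expR.
      rewrite (_ : 1 / 5 / lP * ln p%:R = 1 / 5 * (ln p%:R / lP)); last by ring.
      by rewrite -[leLHS]mulr1 ler_wpM2l// ler_pdivlMr// mul1r.
    rewrite invf_ple ?posrE ?expR_gt0// hp4.
    have h := expR_ge1Dx (1 / 5 / 4 : R).
    apply: le_trans (_ : (1 + 1 / 5 / 4) ^+ 4 <= _); first by lra.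
    by rewrite lerXn2r ?nnegrE ?expR_ge0//; lra.
  have hth : 0 <= sg + th <= 1.
    have : 1 / 5 / lP <= sg by rewrite sgE ler_pM2r ?invr_gt0//; move: hX4; lra.
    by rewrite /th; move: sg3 thp; lra.
  apply: le_trans (_ : \sum_(1 <= n < m1.+1) 2 * expR (33 / 40 * Lam) * n%:R `^ (1 / 5 / lP - 1) <= _).
    rewrite big_nat_cond [leRHS]big_nat_cond; apply: ler_sum => n /andP[/andP[n0 _] _].
    have := abel_term_le hB hth n0.
    by rewrite /th opprK [- 1 + _]addrC.
  rewrite -big_distrr /=.
  have h1 : 1 / 5 / lP <= 1 by rewrite ler_pdivrMr//; move: hlP; lra.
  have thp1 : 0 < 1 / 5 / lP <= 1 by rewrite thp.
  apply: le_trans (ler_wpM2l _ (sum_powR_le m1 thp1)) _.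
    by rewrite mulr_ge0// expR_ge0.
  have h2 : m1%:R `^ (1 / 5 / lP) <= expR (4 / 25 * Lam).
    apply: le_trans (_ : Y `^ (1 / 5 / lP) <= _).
      by apply: ge0_ler_powR; rewrite ?nnegrE ?ler0n ?(ltW thp) ?expR_ge0.
    rewrite powRE ?expR_gt0// expRK ler_expR le_eqVlt; apply/orP; left; apply/eqP.
    by field; rewrite gt_eqF.
  rewrite /e98 (_ : 197 / 200 * Lam = 33 / 40 * Lam + 4 / 25 * Lam); last by field.
  rewrite expRD.
  rewrite (_ : 2 * expR (33 / 40 * Lam) * (m1%:R `^ (1 / 5 / lP) / (1 / 5 / lP)) =
     (10 * lP * expR (33 / 40 * Lam)) * m1%:R `^ (1 / 5 / lP)); last first.
    by field; rewrite gt_eqF.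
  by rewrite [leRHS]mulrA ler_wpM2l// !mulr_ge0 ?expR_ge0// ltW.
(* Large n: exponent sg + 3/(10 lP), where exp(63/200) <= 7/5 and
   7/5 - 21/50 = 98/100 < 197/200. *)
have S3 : \sum_(M.+1 <= n < N.+1) F n <= 7 * lP * e98.
  pose th := 3 / 10 / lP.
  have thp : 0 < th by rewrite divr_gt0.
  have hB p : p \in W -> p%:R `^ th <= 7 / 5.
    move=> pW; have p0 := W_gt0 pW; have /andP[l1 l2] := hlo pW.
    rewrite powRE// /th.
    apply: le_trans (_ : expR (63 / 200) <= _).
      rewrite ler_expR (_ : 63 / 200 = 3 / 10 * (21 / 20) :> R); last by field.
      rewrite (_ : 3 / 10 / lP * ln p%:R = 3 / 10 * (ln p%:R / lP)); last by ring.
      by rewrite ler_wpM2l// ler_pdivrMr.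
    rewrite hp4.
    have h := expR_ge1Dx (- (63 / 200 / 4) : R).
    have h0 : 0 < 1 + - (63 / 200 / 4) :> R by lra.
    have h2 : expR (63 / 200 / 4) <= (1 + - (63 / 200 / 4))^-1 :> R.
      by rewrite -[leLHS]invrK -expRN lef_pV2 ?posrE ?expR_gt0.
    apply: le_trans (_ : ((1 + - (63 / 200 / 4))^-1) ^+ 4 <= _).
      by rewrite lerXn2r ?nnegrE ?expR_ge0// invr_ge0 ltW.
    rewrite exprVn invf_ple ?posrE ?exprn_gt0//; lra.
  have hth : 0 <= sg + th <= 1.
    have : th <= 1 / 3 by rewrite /th ler_pdivrMr//; move: hlP; lra.
    by move: sg3 sg0 thp; lra.
  apply: le_trans (_ : \sum_(M.+1 <= n < N.+1) 2 * expR (7 / 5 * Lam) * n%:R `^ (- 1 - th) <= _).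
    rewrite big_nat_cond [leRHS]big_nat_cond; apply: ler_sum => n /andP[/andP[n0 _] _].
    by apply: abel_term_le hB hth _; apply: leq_ltn_trans n0.
  rewrite -big_distrr /=.
  apply: le_trans (ler_wpM2l _ (sum_powR_tail_le thp M0 MN)) _.
    by rewrite mulr_ge0// expR_ge0.
  have h2 : M%:R `^ (- th) <= expR (- (21 / 50 * Lam)).
    rewrite powRN expRN lef_pV2 ?posrE ?powR_gt0 ?expR_gt0 ?ltr0n//.
    apply: le_trans (_ : expR (7 / 5 * Lam * lP) `^ th <= _); last first.
      by apply: ge0_ler_powR; rewrite ?nnegrE ?ler0n ?(ltW thp) ?expR_ge0.
    rewrite powRE ?expR_gt0// expRK ler_expR le_eqVlt; apply/orP; left; apply/eqP.
    by rewrite /th; field; rewrite gt_eqF.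
  apply: le_trans (_ : 7 * lP * expR (98 / 100 * Lam) <= _); last first.
    rewrite ler_wpM2l ?mulr_ge0 ?(ltW lP0)// ler_expR ler_wpM2r//; lra.
  rewrite (_ : 98 / 100 * Lam = 7 / 5 * Lam + - (21 / 50 * Lam)); last by field.
  rewrite expRD.
  apply: le_trans (ler_wpM2l _ (ler_wpM2r _ h2)) _.
  - by rewrite mulr_ge0// expR_ge0.
  - by rewrite invr_ge0 ltW.
  rewrite /th (_ : _ * (_ / _) = 20 / 3 * lP * (expR (7 / 5 * Lam) * expR (- (21 / 50 * Lam)))); last first.
    by field; rewrite gt_eqF.
  rewrite ler_wpM2r ?mulr_ge0 ?expR_ge0// ler_wpM2r ?(ltW lP0)//; lra.
have S2 : \sum_(m1.+1 <= n < M.+1) F n <= 4 * d1 * expR (7 / 5 * Lam * X) / sg.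
  apply: le_trans (_ : \sum_(1 <= n < M.+1) 2 * d1 * n%:R `^ (sg - 1) <= _).
    rewrite [leRHS](big_cat_nat (n := m1.+1))//=.
    rewrite -[leLHS]add0r; apply: lerD.
      by apply: sumr_ge0 => n _; rewrite !mulr_ge0// powR_ge0.
    rewrite big_nat_cond [leRHS]big_nat_cond; apply: ler_sum => n /andP[/andP[n0 nM] _].
    have n1 : (0 < n)%N by apply: leq_ltn_trans n0.
    have n0' : (0 : R) < n%:R by rewrite ltr0n.
    have nY : Y <= n%:R.
      by apply: le_trans (ltW Ym1) _; rewrite ler_nat.
    apply: le_trans (_ : d1 * n%:R * (2 * n%:R `^ (sg - 2)) <= _).
      apply: ler_pM => //; [|exact: hE|exact: abel_weight_le].
      rewrite mulr_ge0 ?divr_ge0 ?normc_ge0 ?(ltW rho0)// subr_ge0 !powRN.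
      rewrite lef_pV2 ?posrE ?powR_gt0// ?ltr0n//.
      by apply: ge0_ler_powR; rewrite ?nnegrE ?ler0n ?(ltW rho0)// ler_nat.
    rewrite (_ : sg - 1 = 1 + (sg - 2)); last by ring.
    rewrite [in leRHS]powRD ?(gt_eqF n0') ?implybT// powRr1 ?(ltW n0')//.
    by rewrite le_eqVlt; apply/orP; left; apply/eqP; ring.
  rewrite -big_distrr /=.
  have sg01 : 0 < sg <= 1 by rewrite sg0 /=; move: sg3; lra.
  apply: le_trans (ler_wpM2l _ (sum_powR_le M sg01)) _; first by rewrite mulr_ge0.
  have h2 : M%:R `^ sg <= 2 * expR (7 / 5 * Lam * X).
    apply: le_trans (_ : (2 * expR (7 / 5 * Lam * lP)) `^ sg <= _).
      by apply: ge0_ler_powR; rewrite ?nnegrE ?ler0n ?(ltW sg0)// mulr_ge0 ?expR_ge0.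
    rewrite powRM ?expR_ge0// ler_pM ?powR_ge0//.
      by apply: ler1_powR; [lra|move: sg3; lra].
    rewrite powRE ?expR_gt0// expRK ler_expR le_eqVlt; apply/orP; left; apply/eqP.
    by rewrite /X; ring.
  rewrite mulrA ler_wpM2r ?invr_ge0 ?(ltW sg0)//.
  apply: le_trans (ler_wpM2l _ h2) _; first by rewrite mulr_ge0.
  by rewrite le_eqVlt; apply/orP; left; apply/eqP; ring.
rewrite eS => hmain.
have w0 : 0 < normc w by apply: normc_w_gt0.
have wE : w = sg +i* t by rewrite /w /rho; congr (_ +i* _); ring.
have w1 : normc w <= sg + t.
  by rewrite wE; apply: le_trans (normc_le_abs _ _) _; rewrite !gtr0_norm.
have w2 : normc w <= 2 * sg by move: t_le_sg; lra.
have w3 : normc w <= 43 / 125 by move: tsmall sg3; lra.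
have s1 : normc s / rho <= 51 / 50.
  rewrite ler_pdivrMr//; apply: le_trans (normc_le_abs _ _) _.
  by rewrite normrN !gtr0_norm// /rho; move: tsmall sg3; lra.
have Gn := sieve_euler_product_ge.
have GG : normc (sieve_euler_product rho t g W) - 1 <= normc (sieve_euler_product rho t g W - (sieve_mean g W)%:C).
  have := le_normcD (sieve_euler_product rho t g W - (sieve_mean g W)%:C) (sieve_mean g W)%:C.
  rewrite subrK normc_real; have /andP[g0 g1] := sieve_mean01.
  by rewrite ger0_norm//; lra.
have e994 : (340 * X + 50) * e98 <= expR (99 / 100 * Lam).
  rewrite (_ : 99 / 100 * Lam = 1 / 200 * Lam + 197 / 200 * Lam); last by field.
  by rewrite expRD ler_wpM2r// expR_ge0.
set D := expR _ in S2 *.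
set V := normc w in hmain w0 w2 w3.
set nG := normc (_ - _) in hmain GG.
(* The pole term 1/|w| exceeds 1 + |s|/rho by at least 1/(4 |w|), since
   |w| <= 43/125 and |s|/rho <= 51/50. *)
have hz : 1 / 4 <= V * (V^-1 - 1 - normc s / rho).
  have : V * V^-1 = 1 by rewrite divff ?gt_eqF.
  have : V * (normc s / rho) <= 43 / 125 * (51 / 50).
    by rewrite ler_pM ?(ltW w0)// divr_ge0 ?normc_ge0// ltW.
  by rewrite !mulrBr mulr1; lra.
have nG0 : 0 <= nG by apply: normc_ge0.
have D0 : 0 <= D by apply: expR_ge0.
have e0 : 0 <= e98 by lra.
have key : 1 / 4 * nG <= 34 * X * e98 + 8 * d1 * D + 1.
  apply: le_trans (ler_wpM2r nG0 hz) _; rewrite -[leLHS]mulrA.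
  apply: le_trans (ler_wpM2l (ltW w0) hmain) _.
  apply: le_trans (_ : V * (17 * lP * e98 + 4 * d1 * D / sg + 1) <= _).
    by rewrite ler_wpM2l ?(ltW w0)//; lra.
  rewrite mulrDr mulr1; apply: lerD; last by lra.
  apply: le_trans (_ : 2 * sg * (17 * lP * e98 + 4 * d1 * D / sg) <= _).
    have u1 : 0 <= 17 * lP * e98 by rewrite !mulr_ge0 ?(ltW lP0).
    have u2 : 0 <= 4 * d1 * D / sg by rewrite !mulr_ge0 ?invr_ge0 ?(ltW sg0).
    by rewrite ler_wpM2r// addr_ge0.
  rewrite le_eqVlt; apply/orP; left; apply/eqP.
  have -> : 2 * sg * (17 * lP * e98 + 4 * d1 * D / sg) = 34 * (sg * lP) * e98 + 8 * d1 * D * (sg / sg) by ring.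
  by rewrite divff ?gt_eqF// mulr1.
have Xe : 0 <= X * e98 by rewrite mulr_ge0// ltW.
by move: key GG Gn e994 e98_1 Xe; rewrite mulrDl; lra.
Qed.

End Oscillation.

Local Close Scope complex_scope.

(** * The local densities of a squarefree modulus *)

Section SquareFree.
Variable R : realType.
Variables (W : seq nat) (h : nat -> R).
Hypothesis Wp : all prime W.
Hypothesis Wu : uniq W.
Hypothesis h01 : forall n : nat, (0 < n)%N -> 0 <= h n <= 1.
Hypothesis h1 : h 1%N = 1.

(** This is 1 - f_q(p) for a squarefree multiple q of p. *)
Definition local_defect (p : nat) : R := (1 - h p) / (1 - h p / p%:R).
Let q := (\prod_(p <- W) p)%N.

Lemma prod_primes_gt0 V : all prime V -> (0 < \prod_(p <- V) p)%N.
Proof.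
by move=> Vp; rewrite big_seq prodn_cond_gt0// => p pV; rewrite prime_gt0// (allP Vp).
Qed.

Lemma dvd_prod_primes V p : all prime V -> prime p ->
  (p %| \prod_(r <- V) r)%N = (p \in V).
Proof.
move=> + pp; elim: V => [|r V IH] /=; first by rewrite big_nil dvdn1; case: eqP pp => // ->.
move=> /andP[rp Vp]; rewrite big_cons Euclid_dvdM// IH// inE dvdn_prime2//.
Qed.

Lemma logn_prod_primes V p : all prime V -> uniq V -> p \in V ->
  logn p (\prod_(r <- V) r) = 1%N.
Proof.
elim: V => //= r V IH /andP[rp Vp] /andP[rV uV].
have r0 := prime_gt0 rp; have V0 := prod_primes_gt0 Vp.
rewrite inE big_cons lognM//= logn_prime// => /orP[/eqP->|pV].
  rewrite eqxx lognE rp prod_primes_gt0//= dvd_prod_primes//.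
  by rewrite (negbTE rV).
rewrite IH// (_ : (p == r) = false)//; apply: contraNF rV => /eqP <-; exact: pV.
Qed.

Lemma primes_prod : perm_eq (primes q) W.
Proof.
apply: uniq_perm; rewrite ?primes_uniq// => p.
rewrite mem_primes prod_primes_gt0//=.
have [pp|npp] := boolP (prime p); first by rewrite dvd_prod_primes.
by apply/esym/negbTE; apply: contra npp => /(allP Wp).
Qed.

Lemma local_defect_den_gt0 p : prime p -> 0 < 1 - h p / p%:R.
Proof.
move=> pp; have p1 : (1 : R) < p%:R by rewrite ltr1n prime_gt1.
have /andP[a b] := h01 (prime_gt0 pp).
by rewrite subr_gt0 ltr_pdivrMr ?mul1r ?(le_lt_trans b)//; lra.
Qed.

Lemma local_defect_bounds p : prime p -> 1 - h p <= local_defect p <= 1.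
Proof.
move=> pp; have p1 : (1 : R) < p%:R by rewrite ltr1n prime_gt1.
have p0 : (0 : R) < p%:R by lra.
have /andP[a b] := h01 (prime_gt0 pp).
have d := local_defect_den_gt0 pp.
rewrite /local_defect ler_pdivlMr// ler_pdivrMr// mul1r; apply/andP; split.
  rewrite ler_piMr ?subr_ge0// gerBl divr_ge0// ltW//.
rewrite lerD2l lerN2 ler_pdivrMr// ler_peMr// ltW//.
Qed.

Lemma gamma_qE : gamma_q h q = sieve_mean local_defect W.
Proof.
rewrite /gamma_q (perm_big _ primes_prod) /sieve_mean big_seq [RHS]big_seq.
apply: eq_bigr => p /(allP Wp) pp.
have p1 : (1 : R) < p%:R by rewrite ltr1n prime_gt1.
have d := local_defect_den_gt0 pp; rewrite /local_defect.
have p0 : p%:R != 0 :> R by rewrite gt_eqF//; lra.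
have p10 : p%:R - 1 != 0 :> R by rewrite gt_eqF//; lra.
have d' : p%:R - h p != 0.
  have e : p%:R - h p = p%:R * (1 - h p / p%:R) by rewrite mulrBr mulr1 mulrCA divff// mulr1.
  by rewrite e mulf_neq0// gt_eqF.
field; rewrite ?p0 ?p10 ?d'//.
Qed.

Lemma f_qzE (s : nat) : f_qz h q s%:Z = sieve_weight local_defect W s.
Proof.
rewrite /f_qz /f_q /sieve_weight absz_nat.
have q0 : (0 < q)%N by apply: prod_primes_gt0.
have g0 : (0 < gcdn s q)%N by rewrite gcdn_gt0 q0 orbT.
have pe : perm_eq (primes (gcdn s q)) [seq p <- W | (p %| s)%N].
  apply: uniq_perm; rewrite ?primes_uniq ?filter_uniq// => p.
  rewrite mem_primes g0 mem_filter /= dvdn_gcd.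
  have [pp|npp] := boolP (prime p); first by rewrite dvd_prod_primes.
  apply/esym/negbTE; apply: contra npp => /andP[_]; exact: (allP Wp).
rewrite (perm_big _ pe) big_filter big_seq_cond [RHS]big_seq_cond.
apply: eq_bigr => p /andP[pW ps]; have pp := allP Wp p pW.
rewrite /f_q_primepow dvd_prod_primes// pW /= logn_prod_primes//.
have -> : (logn p (gcdn s q) < 1)%N = false.
  rewrite ltnS leqn0 lognE pp g0 dvdn_gcd ps /= dvd_prod_primes// pW//.
rewrite expn1.
have p1 : (1 : R) < p%:R by rewrite ltr1n prime_gt1.
have d := local_defect_den_gt0 pp; rewrite /local_defect.
have p0 : p%:R != 0 :> R by rewrite gt_eqF//; lra.
have d' : p%:R - h p != 0.
  have e : p%:R - h p = p%:R * (1 - h p / p%:R) by rewrite mulrBr mulr1 mulrCA divff// mulr1.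
  by rewrite e mulf_neq0// gt_eqF.
field; rewrite ?p0 ?d'//.
Qed.

Lemma sieve_errorE (n : nat) :
  sieve_error local_defect W n%:R = \sum_(1 <= s < n.+1) f_qz h q s%:Z - gamma_q h q * n%:R.
Proof.
rewrite /sieve_error natrK gamma_qE; congr (_ - _).
by apply: eq_bigr => s _; rewrite f_qzE.
Qed.

(** Each factor p/(p - 1) is at most 1 + 2/p. *)
Lemma totient_ratio : (q%:R : R) / (totient q)%:R <= expR (2 * \sum_(p <- W) (p%:R)^-1).
Proof.
rewrite /q; elim: W Wp Wu => [|p V IH]; first by rewrite !big_nil mulr0 expR0 divr1.
move=> /= /andP[pp Vp] /andP[pV uV]; rewrite !big_cons.
have p1 : (2 : R) <= p%:R by rewrite ler_nat prime_gt1.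
rewrite totient_coprime; last first.
  by rewrite prime_coprime// dvd_prod_primes.
rewrite totient_prime// !natrM -mulf_div mulrDr expRD.
apply: ler_pM; rewrite ?divr_ge0 ?ler0n//; last exact: IH.
apply: le_trans (expR_ge1Dx _).
rewrite -subn1 natrB ?prime_gt0// ler_pdivrMr; last by lra.
have -> : (1 + 2 / p%:R) * (p%:R - 1) = p%:R + 1 - 2 / p%:R :> R.
  by field; rewrite gt_eqF//; lra.
have : 2 / p%:R <= 1 :> R by rewrite ler_pdivrMr; lra.
by lra.
Qed.

End SquareFree.

Section Tilt.
Variable R : realType.

Lemma continuous_tilted_sum (W : seq nat) (g : nat -> R) : (forall p, p \in W -> (0 < p)%N) ->
  continuous (fun s : R => \sum_(p <- W) g p * p%:R `^ (s - 1)).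
Proof.
elim: W => [|p W IH] hW.
  by move=> s; rewrite (_ : (fun s : R => _) = cst 0); [exact: cvg_cst|apply/funext => y; rewrite big_nil].
have {}IH : continuous (fun s : R => \sum_(p <- W) g p * p%:R `^ (s - 1)).
  by apply: IH => r rW; apply: hW; rewrite inE rW orbT.
have p0 : (0 : R) < p%:R by rewrite ltr0n hW// mem_head.
move=> s; rewrite (_ : (fun s : R => _) = (fun s : R => g p * expR ((s - 1) * ln p%:R)) \+
   (fun s => \sum_(p <- W) g p * p%:R `^ (s - 1))); last first.
  by apply/funext => y; rewrite big_cons/= powRE.
apply: cvgD; last exact: IH.
apply: cvgM; first exact: cvg_cst.
apply: (@continuous_comp _ _ _ (fun s : R => (s - 1) * ln p%:R) expR); last exact: continuous_expR.
apply: cvgM; last exact: cvg_cst.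
apply: cvgB; [exact: cvg_id|exact: cvg_cst].
Qed.

End Tilt.

(** * Quantitative oscillation *)

Section Quantitative.
Variable R : realType.

(** p^sg lies between exp(sg lP) and its power 21/20 on the window. *)
Lemma tilted_sum_bounds (W : seq nat) (g : nat -> R) (lP sg : R) :
  all prime W -> (forall p, p \in W -> 0 <= g p) ->
  (forall p, p \in W -> lP <= ln (p%:R : R) <= 21 / 20 * lP) -> 0 <= sg ->
  expR (sg * lP) * \sum_(p <- W) g p / p%:R <= \sum_(p <- W) g p * p%:R `^ (sg - 1)
   <= expR (21 / 20 * (sg * lP)) * \sum_(p <- W) g p / p%:R.
Proof.
move=> Wp hg hl sg0.
have e p : p \in W -> g p * p%:R `^ (sg - 1) = expR (sg * ln p%:R) * (g p / p%:R).
  move=> pW; have p0 : (0 : R) < p%:R by rewrite ltr0n prime_gt0// (allP Wp).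
  by rewrite powRB ?(gt_eqF p0) ?implybT// powRr1 ?(ltW p0)// powRE//; ring.
rewrite !big_distrr/=; apply/andP; split; rewrite big_seq [leRHS]big_seq;
  apply: ler_sum => p pW; have /andP[l1 l2] := hl p pW; have g0 := hg p pW;
  rewrite e// ler_wpM2r ?divr_ge0 ?ler0n// ler_expR.
  by rewrite ler_wpM2l.
by rewrite mulrCA ler_wpM2l.
Qed.

(** Intermediate value theorem between sg = 0 and sg = 1/3. *)
Lemma exists_tilt (W : seq nat) (g : nat -> R) (lP Lam : R) :
  all prime W -> (forall p, p \in W -> 0 <= g p) ->
  (forall p, p \in W -> lP <= ln (p%:R : R) <= 21 / 20 * lP) -> 
  \sum_(p <- W) g p / p%:R <= Lam ->
  Lam <= expR (lP / 3) * \sum_(p <- W) g p / p%:R ->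
  exists2 sg, 0 <= sg <= 1 / 3 & \sum_(p <- W) g p * p%:R `^ (sg - 1) = Lam.
Proof.
move=> Wp hg hl h1 h2.
pose f (s : R) := \sum_(p <- W) g p * p%:R `^ (s - 1).
have fc : continuous f.
  by apply: continuous_tilted_sum => p pW; rewrite prime_gt0// (allP Wp).
have i13 : 0 <= 1 / 3 :> R by lra.
have f0 : f 0 <= Lam.
  have /andP[_] := tilted_sum_bounds Wp hg hl (lexx 0).
  by rewrite mul0r mulr0 expR0 mul1r => h; apply: le_trans h1.
have f1 : Lam <= f (1 / 3).
  have /andP[h _] := tilted_sum_bounds Wp hg hl i13.
  by apply: le_trans h; rewrite (_ : 1 / 3 * lP = lP / 3)//; ring.
have [|s] := @IVT R f 0 (1 / 3) Lam i13 (continuous_subspaceT fc).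
  by rewrite ge_min f0 /= le_max f1 orbT.
by rewrite in_itv/= => hs fs; exists s.
Qed.

Lemma expR1_le4 : expR 1 <= 4 :> R.
Proof.
have h := expR_ge1Dx (- (1 / 2) : R).
have e : expR (1 / 2) <= 2 :> R.
  have e0 := expR_gt0 (1 / 2 : R); rewrite expRN in h.
  have := ler_wpM2l (ltW e0) h; rewrite mulfV ?gt_eqF//; lra.
have -> : expR 1 = expR (1 / 2) ^+ 2 :> R.
  by rewrite -expRM_natl; congr expR; field.
have := expR_ge0 (1 / 2 : R); move: e; set y := expR _ => y2 y0.
by rewrite expr2; nra.
Qed.

Lemma expR_quartic (z : R) : 0 <= z -> z ^+ 4 / 24 <= expR z.
Proof.
move=> z0; have := @expR_ge1Dxn R z 3 z0.
by rewrite (_ : 4`! = 24)//; apply: le_trans; rewrite lerDr.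
Qed.

(** The tilt sg is chosen with Lam = (5/4) u L/lP, so that the middle range of
    sieve_error_not_small starts at exp(u L).  With Q = 2u/eta^3 the density
    of the window gives exp(sg lP) <= Lam/lam <= Q, and lP >= (9/5) eta L gives
    (7/5) Lam <= u/eta, so the error is about Q^(-u/eta). *)
Lemma sieve_error_large (W : seq nat) (g : nat -> R) (lP L eta u d1 : R) :
  all prime W -> uniq W -> (forall p, p \in W -> 0 <= g p <= 1) ->
  (forall p, p \in W -> lP <= ln (p%:R : R) <= 21 / 20 * lP) ->
  9 / 5 * eta * L <= lP -> lP <= L -> 0 < eta -> eta <= 1 / 100 ->
  20 * ln L <= eta * L -> 100 <= ln L ->
  eta / 250 <= \sum_(p <- W) g p / p%:R -> \sum_(p <- W) g p / p%:R <= 1 ->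
  5 / eta ^+ 2 <= u -> u <= eta * expR (eta * L / 2) ->
  0 <= d1 -> 16 * d1 * expR (u / eta * ln (2 * u / eta ^+ 3)) < 1 ->
  exists n : nat, [/\ expR (u * L) <= n%:R, n%:R <= 2 * expR (7 / 4 * (u * L)) &
    d1 * n%:R < `|sieve_error g W n%:R|].
Proof.
move=> Wp Wu hg hl lPl lPL e0 e1 eL lnL1 lam1 lam2 u1 u2 d10 hd.
set lam := \sum_(p <- W) _ in lam1 lam2.
have hg0 p : p \in W -> 0 <= g p by move=> /hg/andP[].
have L0 : 0 < L by rewrite ltNge; apply/negP => /ln0; move: lnL1; clear; lra.
have eL0 : 2000 <= eta * L by move: eL lnL1; clear; lra.
have lP4 : 400 <= lP by move: lPl eL0; clear; lra.
have lP0 : 0 < lP by move: lP4; clear; lra.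
have e20 : 0 < eta ^+ 2 by rewrite exprn_gt0.
have e30 : 0 < eta ^+ 3 by rewrite exprn_gt0.
have u0 : 0 < u by apply: lt_le_trans u1; rewrite divr_gt0.
have u50 : 5 * (100 * 100) <= u.
  apply: le_trans u1; rewrite ler_pdivlMr//.
  have : eta ^+ 2 <= 1 / 100 * (1 / 100) by rewrite expr2 ler_pM ?(ltW e0).
  lra.
pose Lam := 5 / 4 * (u * L / lP).
pose Q := 2 * u / eta ^+ 3.
have Q0 : 0 < Q by rewrite divr_gt0 ?mulr_gt0.
have lam0 : 0 < lam by move: lam1 e0; clear; lra.
have Lam_ge : 5 / 4 * u <= Lam.
  rewrite /Lam ler_wpM2l// -mulrA ler_peMr ?(ltW u0)//.
  by rewrite ler_pdivlMr// mul1r.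
have Lam_le : Lam <= 25 / 36 * (u / eta).
  rewrite /Lam -mulrA mulrA.
  have : u * L / lP <= 5 / 9 * (u / eta).
    rewrite ler_pdivrMr// (_ : 5 / 9 * (u / eta) * lP = (5 / 9 * lP / eta) * u); last by ring.
    rewrite mulrC ler_wpM2r ?(ltW u0)// ler_pdivlMr//; lra.
  rewrite -mulrA; lra.
have eV : eta^-1 <= L / 20.
  by rewrite -[leLHS]mul1r ler_pdivrMr// mulrAC ler_pdivlMr// mul1r mulrC; move: eL0; clear; lra.
have QLam : 250 * Lam <= eta * Q.
  have -> : eta * Q = 2 / eta * (u / eta) by rewrite /Q; field; rewrite gt_eqF.
  have ue : 0 <= u / eta by rewrite divr_ge0 ?ltW.
  apply: le_trans (_ : 200 * (u / eta) <= _); first by move: Lam_le ue; clear; lra.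
  by rewrite ler_wpM2r// ler_pdivlMr//; move: e1; clear; lra.
have LQ : Lam <= lam * Q.
  apply: le_trans (ler_wpM2r (ltW Q0) lam1).
  by move: QLam; clear; lra.
(* This keeps sg below 1/3: Q <= L^2 exp(eta L/2) <= exp((3/5) eta L). *)
have Qexp : Q <= expR (lP / 3).
  apply: le_trans (_ : expR (2 * ln L + eta * L / 2) <= _); last first.
    by rewrite ler_expR; move: lPl eL; clear; lra.
  rewrite expRD expRM_natl lnK ?posrE//.
  apply: le_trans (_ : 2 * (eta * expR (eta * L / 2)) / eta ^+ 3 <= _).
    by rewrite /Q ler_wpM2r ?invr_ge0 ?(ltW e30)// ler_wpM2l.
  rewrite (_ : _ / eta ^+ 3 = 2 * (eta^-1) ^+ 2 * expR (eta * L / 2)); last first.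
    by field; rewrite gt_eqF.
  rewrite ler_wpM2r ?expR_ge0//.
  have : eta^-1 ^+ 2 <= (L / 20) ^+ 2.
    by rewrite lerXn2r ?nnegrE ?invr_ge0 ?divr_ge0 ?(ltW e0) ?(ltW L0).
  have := sqr_ge0 L; rewrite expr_div_n => h1 h2.
  rewrite (_ : 20 ^+ 2 = 400 :> R) in h2; last by ring.
  by move: h1 h2; clear; lra.
have Lam50 : 6 * (100 * 100) <= Lam by move: Lam_ge u50; clear; lra.
have Lam0 : 0 < Lam by move: Lam50; clear; lra.
have hS1 : lam <= Lam by move: lam2 Lam50; clear; lra.
have hS2 : Lam <= expR (lP / 3) * lam.
  by apply: le_trans LQ _; rewrite mulrC ler_wpM2r ?(ltW lam0).
have [sg /andP[sg0 sg3] hsg] := exists_tilt Wp hg0 hl hS1 hS2.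
have /andP[b1 b2] := tilted_sum_bounds Wp hg0 hl sg0.
rewrite hsg -/lam in b1 b2.
set X := sg * lP in b1 b2.
have XQ : X <= ln Q.
  rewrite -[leLHS]expRK ler_ln ?posrE ?expR_gt0//.
  rewrite -(ler_pM2r lam0) [leRHS]mulrC; exact: le_trans LQ.
have X3 : X <= lP / 3.
  by rewrite /X mulrC -[3]invrK -[_ * 3^-1^-1^-1]/(lP / 3^-1^-1) invrK ler_wpM2l ?(ltW lP0)// -div1r.
have X4 : 4 <= X.
  rewrite leNgt; apply/negP => X4.
  have : expR (21 / 20 * X) <= 4 ^+ 5.
    apply: le_trans (_ : expR (5 * 1) <= _).
      by rewrite ler_expR; move: X4; clear; lra.
    by rewrite expRM_natl lerXn2r ?nnegrE ?expR_ge0// expR1_le4.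
  have e0' := expR_ge0 (21 / 20 * X).
  have h2 : Lam <= expR (21 / 20 * X).
    by apply: le_trans b2 _; rewrite ler_piMr.
  move=> h3; have := le_trans h2 h3; move: Lam50; rewrite (_ : 4 ^+ 5 = 1024 :> R); last by ring.
  by clear; lra.
have hexp : 340 * X + 50 <= expR (1 / 200 * Lam).
  (* Crude: Q <= 2 u^3 <= Lam^4, as 1/eta^2 <= u. *)
  have X4L : X <= 4 * Lam.
    apply: le_trans XQ _.
    have uV : eta^-1 ^+ 2 <= u.
      apply: le_trans u1; rewrite exprVn ler_peMl ?invr_ge0 ?(ltW e20)//.
      by rewrite ler1n.
    have Qu : Q <= 2 * u ^+ 3.
      have -> : Q = 2 * u * eta * (eta^-1 ^+ 2) ^+ 2.
        by rewrite /Q; field; rewrite gt_eqF.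
      have h1 : (eta^-1 ^+ 2) ^+ 2 <= u ^+ 2 by rewrite lerXn2r ?nnegrE ?sqr_ge0 ?(ltW u0).
      have h0 : 0 <= 2 * u * eta by rewrite !mulr_ge0 ?(ltW u0) ?(ltW e0).
      apply: le_trans (ler_wpM2l h0 h1) _.
      rewrite (_ : 2 * u ^+ 3 = 2 * u * 1 * u ^+ 2); last by ring.
      rewrite ler_wpM2r ?sqr_ge0// ler_wpM2l ?mulr_ge0 ?(ltW u0)//.
      by move: e1; clear; lra.
    have uL : u <= Lam by move: Lam_ge u0; clear; lra.
    have QL : Q <= Lam ^+ 4.
      apply: le_trans Qu _; rewrite [leRHS]exprS; apply: ler_pM => //.
      - by rewrite exprn_ge0// ltW.
      - by move: Lam50; clear; lra.
      - by rewrite lerXn2r ?nnegrE ?(ltW u0) ?(ltW Lam0).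
    apply: le_trans (_ : ln (Lam ^+ 4) <= _).
      by rewrite ler_ln ?posrE ?exprn_gt0.
    rewrite lnXn// -[leLHS]mulr_natl ler_wpM2l//.
    by rewrite ltW// ln_sublinear.
  have [z zE] : exists z, Lam = 200 * z by exists (Lam / 200); field.
  have z300 : 300 <= z by move: Lam50; rewrite zE; clear; lra.
  rewrite (_ : 1 / 200 * Lam = z); last by rewrite zE; field.
  have z0 : 0 <= z by move: z300; clear; lra.
  apply: le_trans (expR_quartic z0).
  apply: le_trans (_ : 300 * 300 * 300 * z / 24 <= _); last first.
    have hc c : 0 <= c -> c <= z -> c * c * c * z <= z ^+ 4.
      move=> c0 cz; rewrite (_ : z ^+ 4 = z * z * z * z); last by ring.
      by rewrite ler_wpM2r// ler_pM ?mulr_ge0// ler_pM.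
    apply: ler_wpM2r; first by rewrite invr_ge0 ler0n.
    exact: (hc _ (ler0n _ 300) z300).
  move: X4L; rewrite zE; move: z300; clear; lra.
pose M := (Num.truncn (expR (7 / 5 * Lam * lP))).+1.
have LamlP : Lam * lP = 5 / 4 * (u * L) by rewrite /Lam; field; rewrite gt_eqF.
have M12 : expR (7 / 5 * Lam * lP) <= M%:R <= 2 * expR (7 / 5 * Lam * lP).
  rewrite /M (ltW (truncnS_gt _))/= -[_.+1%:R]natr1 [leRHS]mulr_natl mulr2n lerD//.
    by rewrite truncn_le expR_ge0.
  by rewrite -expR0 ler_expR -mulrA mulr_ge0// mulr_ge0 ?(ltW Lam0) ?(ltW lP0).
apply: contrapT => hno.
have hE (n : nat) : expR (4 / 5 * Lam * lP) <= n%:R -> (n <= M)%N -> `|sieve_error g W n%:R| <= d1 * n%:R.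
  move=> n1 n2; rewrite leNgt; apply/negP => h; apply: hno; exists n; split => //.
    by apply: le_trans n1; rewrite -mulrA LamlP ler_expR; move: u0; clear; lra.
  apply: le_trans (_ : M%:R <= _); first by rewrite ler_nat.
  have e : 7 / 5 * Lam * lP = 7 / 4 * (u * L) by rewrite -mulrA LamlP; field.
  by have /andP[_] := M12; rewrite e.
have := sieve_error_not_small Wp Wu hg hl hsg lP4 X4 X3 hexp d10 M12 hE.
rewrite leNgt => /negP; apply; apply: le_lt_trans hd.
rewrite ler_wpM2l ?mulr_ge0// ler_expR -/Q.
have lQ0 : 0 <= ln Q by apply: le_trans XQ; move: X4; clear; lra.
have ue : 0 <= u / eta by rewrite divr_ge0 ?ltW.
apply: ler_pM => //.
- by rewrite mulr_ge0// ltW.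
- by apply: le_trans X4.
- by move: Lam_le ue; clear; lra.
Qed.

End Quantitative.

(** * The Maier matrix *)

Section Maier.
Variable R : realType.


Lemma sum_ap_block (F : nat -> R) (q s m : nat) : (0 < q)%N -> m = s %[mod q] ->
  \sum_(m <= k < m + q | (k == s %[mod q])) F k = F m.
Proof.
move=> q0 ms; case: q q0 ms => // q _ ms.
rewrite big_ltn_cond ?addnS ?ltnS ?leq_addr// ms eqxx big1_seq ?addr0// => k.
rewrite mem_index_iota => /andP[/eqP ks /andP[mk km]].
have : (q.+1 %| k - m)%N by rewrite -eqn_mod_dvd ?ks ?ms// ltnW.
move/dvdn_leq; rewrite subn_gt0 => /(_ mk).
by move: km mk; lia.
Qed.

Lemma sum_ap (F : nat -> R) (q s R1 N : nat) : (0 < q)%N ->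
  \sum_(R1 * q + s <= k < (R1 + N) * q + s | k == s %[mod q]) F k =
  \sum_(R1 <= r < R1 + N) F (r * q + s)%N.
Proof.
move=> q0; elim: N => [|N IH]; first by rewrite addn0 !big_geq.
have h1 : (R1 * q + s <= (R1 + N) * q + s)%N by rewrite leq_add2r leq_mul2r leq_addr orbT.
have h2 : ((R1 + N) * q + s <= (R1 + N.+1) * q + s)%N.
  by rewrite leq_add2r leq_mul2r addnS leqnSn orbT.
rewrite (big_cat_nat h1 h2) IH addnS big_nat_recr ?leq_addr//=; congr (_ + _).
rewrite (_ : ((R1 + N).+1 * q + s = (R1 + N) * q + s + q)%N); last first.
  by rewrite mulSn -addnA addnC.
by rewrite sum_ap_block// modnMDl.
Qed.

Lemma summatory_ap_diff (a : nat -> R) (q s R1 N : nat) : (0 < q)%N -> (0 < s)%N ->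
  summatory_ap a ((R1 + N) * q + s).-1%:R q s%:Z -
  summatory_ap a (R1 * q + s).-1%:R q s%:Z = \sum_(R1 <= r < R1 + N) a (r * q + s)%N.
Proof.
move=> q0 s0; rewrite /summatory_ap !natrK -sum_ap//.
have hs r : ((r * q + s).-1.+1 = r * q + s)%N by rewrite prednK// addn_gt0 s0 orbT.
rewrite !hs.
have hP (k : nat) : (k%:Z == s%:Z %[mod q%:Z])%Z = (k == s %[mod q]).
  by rewrite !modz_nat.
under eq_bigl do rewrite hP.
under [X in _ - X]eq_bigl do rewrite hP.
have h1 : (1 <= R1 * q + s)%N by rewrite addn_gt0 s0 orbT.
have h2 : (R1 * q + s <= (R1 + N) * q + s)%N by rewrite leq_add2r leq_mul2r leq_addr orbT.
by rewrite (big_cat_nat h1 h2) /= addrAC subrr add0r.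
Qed.

(** Sum the entries a(r q + s), R1 <= r < R1 + N and 1 <= s <= n, by rows and
    by columns.  Here R1 q is close to x/4 and (R1 + N) q to x/2, so that every
    interval and every endpoint used lies in (x/4, x). *)
Lemma maier_matrix (a : nat -> R) (x rho dl gm : R) (F : nat -> R) (q n : nat) :
  (0 < q)%N -> (0 < n)%N -> 0 < x -> 0 < rho -> 0 <= dl -> 0 < gm ->
  16 * q%:R <= x -> 4 * n%:R <= x ->
  (forall v : nat, x / 4 < v%:R -> v%:R + n%:R < x ->
     `|summatory a (v%:R + n%:R) - summatory a v%:R - n%:R * rho| <= dl * n%:R * rho) ->
  (forall y s : nat, x / 4 < y%:R -> y%:R < x -> (0 < s)%N ->
     `|summatory_ap a y%:R q s%:Z - F s / (q%:R * gm) * y%:R * rho| <=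
       dl * (rho * x / (totient q)%:R)) ->
  `|\sum_(1 <= s < n.+1) F s - gm * n%:R| <=
    gm * (dl * (1 + 16 * (q%:R / (totient q)%:R))) * n%:R.
Proof.
move=> q0 n0 x0 rho0 dl0 gm0 qx nx hrow hcol.
have q0' : (0 : R) < q%:R by rewrite ltr0n.
have n0' : (0 : R) < n%:R by rewrite ltr0n.
have phi0 : (0 : R) < (totient q)%:R by rewrite ltr0n totient_gt0.
pose R1 := (Num.truncn (x / 4 / q%:R)).+1.
pose R2 := Num.truncn (x / 2 / q%:R).
(* R1 q and R2 q are the first multiple of q above x/4 and the last one not
   exceeding x/2. *)
have [R1l R1u] : x / 4 < (R1 * q)%:R /\ (R1 * q)%:R <= x / 4 + q%:R.
  have h0 : 0 <= x / 4 / q%:R by rewrite !divr_ge0// ltW.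
  have /andP[h1 h2] := truncn_itv h0.
  rewrite ler_pdivlMr// in h1; rewrite ltr_pdivrMr// in h2.
  by rewrite !natrM; split => //; rewrite /R1 -[_.+1%:R]natr1 mulrDl mul1r lerD2r.
have [R2l R2u] : x / 2 - q%:R <= (R2 * q)%:R /\ (R2 * q)%:R <= x / 2.
  have h0 : 0 <= x / 2 / q%:R by rewrite !divr_ge0// ltW.
  have /andP[h1 h2] := truncn_itv h0.
  rewrite ler_pdivlMr// in h1; rewrite ltr_pdivrMr// in h2.
  rewrite !natrM; split => //.
  move: h2; rewrite -[(Num.truncn _).+1%:R]natr1 -/R2 mulrDl mul1r; lra.
have R12 : (R1 <= R2)%N.
  rewrite -(leq_pmul2r q0) -(ler_nat R); apply: le_trans R1u _; apply: le_trans R2l; lra.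
pose N := (R2 - R1)%N.
have R2E : R2 = (R1 + N)%N by rewrite subnKC.
have Nq : x / 8 <= N%:R * q%:R.
  have e : N%:R * q%:R = (R2 * q)%:R - (R1 * q)%:R :> R.
    by rewrite R2E !natrM natrD; ring.
  rewrite e; move: R1u R2l; set u1 := (R1 * q)%:R; set u2 := (R2 * q)%:R; lra.
have N0 : (0 : R) < N%:R.
  by rewrite -(pmulr_lgt0 _ q0'); apply: lt_le_trans Nq; rewrite divr_gt0.
set T := \sum_(1 <= s < n.+1) \sum_(R1 <= r < R1 + N) a (r * q + s)%N.
have rowsE : T = \sum_(R1 <= r < R1 + N)
    (summatory a ((r * q)%:R + n%:R) - summatory a (r * q)%:R).
  rewrite /T exchange_big_nat/=; apply: eq_bigr => r _.
  rewrite /summatory -natrD !natrK [X in _ = X - _](big_cat_nat (n := (r * q).+1))//= ?ltnS ?leq_addr//.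
  rewrite addrAC subrr add0r -[(r * q).+1]add1n -[(r * q + n).+1]addnS [(r * q + n.+1)%N]addnC.
  rewrite big_addn addnK; apply: eq_bigr => s _; by rewrite addnC.
have rows : `|T - N%:R * (n%:R * rho)| <= N%:R * (dl * n%:R * rho).
  have e c : N%:R * c = \sum_(R1 <= r < R1 + N) c :> R.
    by rewrite big_const_nat addKn iter_addr_0 mulr_natl.
  rewrite rowsE !e -sumrB; apply: le_trans (ler_norm_sum _ _ _) _.
  rewrite big_nat_cond [leRHS]big_nat_cond; apply: ler_sum => r /andP[/andP[r1 r2] _].
  apply: hrow.
    by apply: lt_le_trans R1l _; rewrite ler_nat leq_mul2r r1 orbT.
  apply: le_lt_trans (_ : (R2 * q)%:R + n%:R < x).
    by rewrite lerD2r ler_nat leq_mul2r R2E (ltnW r2) orbT.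
  move: R2u nx; set u2 := (R2 * q)%:R; move: x0; lra.
have cols : `|T - \sum_(1 <= s < n.+1) F s * (N%:R * rho / gm)| <=
    n%:R * (2 * (dl * (rho * x / (totient q)%:R))).
  have e c : n%:R * c = \sum_(1 <= s < n.+1) c :> R.
    by rewrite big_const_nat subn1 /= iter_addr_0 mulr_natl.
  rewrite e /T -sumrB; apply: le_trans (ler_norm_sum _ _ _) _.
  rewrite big_nat_cond [leRHS]big_nat_cond; apply: ler_sum => s /andP[/andP[s0 sn] _].
  rewrite -summatory_ap_diff//.
  have hs r : ((r * q + s).-1%:R : R) = (r * q)%:R + s%:R - 1.
    by rewrite -natrD -[in RHS](@prednK (r * q + s)) ?addn_gt0 ?s0 ?orbT// -natr1 addrK.
  have s1 : (1 : R) <= s%:R by rewrite ler1n.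
  have sn' : (s%:R : R) <= n%:R by rewrite ler_nat -ltnS.
  have c1 := hcol (R1 * q + s).-1 s; have c2 := hcol ((R1 + N) * q + s).-1 s.
  have u12 : ((R1 * q)%:R : R) <= (R2 * q)%:R by rewrite ler_nat leq_mul2r R12 orbT.
  rewrite -R2E !hs in c1 c2 *.
  have {}c1 : `|summatory_ap a ((R1 * q)%:R + s%:R - 1) q s -
         F s / (q%:R * gm) * ((R1 * q)%:R + s%:R - 1) * rho| <=
      dl * (rho * x / (totient q)%:R).
    apply: c1 => //; move: R1l R2u nx x0 u12 s1 sn';
      set u1 := (R1 * q)%:R; set u2 := (R2 * q)%:R; lra.
  have {}c2 : `|summatory_ap a ((R2 * q)%:R + s%:R - 1) q s -
         F s / (q%:R * gm) * ((R2 * q)%:R + s%:R - 1) * rho| <=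
      dl * (rho * x / (totient q)%:R).
    apply: c2 => //; move: R1l R2u nx x0 u12 s1 sn';
      set u1 := (R1 * q)%:R; set u2 := (R2 * q)%:R; lra.
  set A1 := summatory_ap _ _ _ _ in c1 *; set A2 := summatory_ap _ _ _ _ in c2 *.
  rewrite (_ : A2 - A1 - F s * (N%:R * rho / gm) =
    (A2 - F s / (q%:R * gm) * ((R2 * q)%:R + s%:R - 1) * rho) -
    (A1 - F s / (q%:R * gm) * ((R1 * q)%:R + s%:R - 1) * rho)); last first.
    rewrite R2E !natrM natrD; field.
    by rewrite !gt_eqF.
  apply: le_trans (ler_normB _ _) _.
  by rewrite [leRHS]mulrDl !mul1r lerD.
rewrite -big_distrl /= in cols.
set S := \sum_(1 <= s < n.+1) F s in cols *.
have comb : `|S * (N%:R * rho / gm) - N%:R * (n%:R * rho)| <=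
   N%:R * (dl * n%:R * rho) + n%:R * (2 * (dl * (rho * x / (totient q)%:R))).
  rewrite (_ : S * (N%:R * rho / gm) - N%:R * (n%:R * rho) =
     (T - N%:R * (n%:R * rho)) - (T - S * (N%:R * rho / gm))); last by ring.
  by apply: le_trans (ler_normB _ _) _; exact: lerD.
have c0 : 0 < N%:R * rho / gm by rewrite divr_gt0// mulr_gt0.
have e1 : S * (N%:R * rho / gm) - N%:R * (n%:R * rho) = (N%:R * rho / gm) * (S - gm * n%:R).
  by field; rewrite gt_eqF.
rewrite e1 normrM (gtr0_norm c0) in comb.
rewrite -(ler_pM2l c0); apply: le_trans comb _.
rewrite (_ : N%:R * rho / gm * (gm * (dl * (1 + 16 * (q%:R / (totient q)%:R))) * n%:R) =
   N%:R * (dl * n%:R * rho) + n%:R * (2 * (dl * (rho * (8 * (N%:R * q%:R)) / (totient q)%:R)))); last first.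
  by field; rewrite !gt_eqF.
rewrite lerD2l ler_wpM2l ?(ltW n0')// ler_wpM2l// ler_wpM2l//.
rewrite ler_wpM2r ?invr_ge0 ?(ltW phi0)// ler_wpM2l ?(ltW rho0)//.
by rewrite -ler_pdivrMl// mulrC.
Qed.

End Maier.

(** * Sizes of the modulus and of the interval *)

Section Sizes.
Variable R : realType.

(** By Mertens' estimate the sum of ln p / p over the window is at most
    lP/20 + 6, and ln p > lP. *)
Lemma window_inv_sum_le (lP : R) : 400 <= lP ->
  \sum_(p <- window lP (21 / 20 * lP)) (p%:R : R)^-1 <= 1 / 4.
Proof.
move=> h; have lP0 : 0 < lP by move: h; clear; lra.
have lPl : 0 <= 21 / 20 * lP by move: h; clear; lra.
have ll : lP <= 21 / 20 * lP by move: h; clear; lra.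
have /andP[a1 _] := weighted_mertens1_bounds (ltW lP0).
have /andP[_ b2] := weighted_mertens1_bounds lPl.
have hd := @weighted_mertensB R (fun=> 1) _ _ ll.
have : lP * \sum_(p <- window lP (21 / 20 * lP)) (p%:R : R)^-1 <= lP * (1 / 4).
  apply: le_trans (_ : 21 / 20 * lP + 2 - (lP - 4) <= _); last first.
    by move: h; clear; lra.
  apply: le_trans (_ : weighted_mertens (fun=> 1) (21 / 20 * lP) - weighted_mertens (fun=> 1) lP <= _); last first.
    by apply: lerB.
  rewrite hd big_distrr/= big_seq [leRHS]big_seq; apply: ler_sum => p pw.
  have /andP[l1 _] := window_ln pw.
  by rewrite /= mul1r [leRHS]mulrC ler_wpM2r ?invr_ge0// ltW.
by rewrite ler_pM2l.
Qed.

Lemma window_prod_le (lP z : R) : lP <= z ->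
  (\prod_(p <- window lP z) p)%N%:R <= expR (2 * expR z) :> R.
Proof.
move=> hz; have Wp := window_prime lP z.
rewrite -[leLHS]lnK ?posrE ?ltr0n ?prod_primes_gt0// ler_expR.
rewrite /window big_filter ln_prod_nat; last by move=> i; exact: prime_gt0.
have := chebyshev_theta_le R (Num.truncn (expR z)).
rewrite (big_cat_nat (n := (Num.truncn (expR lP)).+1))//=; last first.
  by rewrite ltnS le_truncn// ler_expR.
have h1 : (Num.truncn (expR z))%:R <= expR z by rewrite truncn_le expR_ge0.
have h2 : 0 <= \sum_(1 <= i < (Num.truncn (expR lP)).+1 | prime i) ln (i%:R : R).
  by apply: sumr_ge0 => i _; exact: ln_nat_ge0.
move: h1 h2; clear; set A := \sum_(_ <= _ < _ | _) _; set B := \sum_(_ <= _ < _ | _) _.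
lra.
Qed.

(** Both quantities are small powers of x: u L <= 2 exp(eta L) is tiny
    compared with ln x = exp L, and so is exp((1 - eta) L). *)
Lemma size_bounds (L eta u : R) : 0 < eta -> eta <= 1 / 100 -> 100 <= eta * L -> 100 <= L ->
  0 < u -> u <= eta * expR (eta * L / 2) ->
  8 * expR (7 / 4 * (u * L)) <= expR (expR L) /\
  16 * expR (2 * expR ((1 - eta) * L)) <= expR (expR L).
Proof.
move=> e0 e1 eL L1 u0 u2.
have L0 : 0 < L by move: L1; clear; lra.
have e2 : 2 <= expR 1 :> R by have := expR_ge1Dx (1 : R); clear; lra.
have pw (n : nat) : 2 ^+ n <= expR (n%:R) :> R.
  by rewrite -[n%:R]mulr1 expRM_natl lerXn2r ?nnegrE ?expR_ge0.
have T50 : 50 <= expR (L / 2) by have := expR_ge1Dx (L / 2); move: L1; clear; lra.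
have TT : expR L = expR (L / 2) * expR (L / 2) by rewrite -expRD; congr expR; field.
set T := expR (L / 2) in T50 TT.
split.
  have h1 : u * L <= 2 * T.
    have y1 : eta * L <= 2 * expR (eta * L / 2).
      by have := expR_ge1Dx (eta * L / 2); move: eL; clear; lra.
    have y2 : expR (eta * L) <= T.
      by rewrite ler_expR; move: L1 (ler_wpM2r (ltW L0) e1); clear; lra.
    have y3 : expR (eta * L / 2) * expR (eta * L / 2) = expR (eta * L).
      by rewrite -expRD; congr expR; field.
    have y4 := expR_ge0 (eta * L / 2).
    apply: le_trans (ler_wpM2r (ltW L0) u2) _.
    rewrite mulrAC; apply: le_trans (ler_wpM2r y4 y1) _.
    by rewrite -[leLHS]mulrA y3 ler_wpM2l.
  apply: le_trans (_ : expR 3 * expR (7 / 4 * (u * L)) <= _).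
    by rewrite ler_wpM2r ?expR_ge0//; have := pw 3; rewrite (_ : 2 ^+ 3 = 8 :> R)//; ring.
  rewrite -expRD ler_expR TT.
  have := ler_wpM2r (le_trans _ T50 : 0 <= T) T50; move/(_ (ler0n _ _)).
  by move: h1 T50; clear; lra.
apply: le_trans (_ : expR 4 * expR (2 * expR ((1 - eta) * L)) <= _).
  by rewrite ler_wpM2r ?expR_ge0//; have := pw 4; rewrite (_ : 2 ^+ 4 = 16 :> R)//; ring.
rewrite -expRD ler_expR.
have h1 : 4 * expR ((1 - eta) * L) <= expR L.
  have -> : expR L = expR (eta * L) * expR ((1 - eta) * L) by rewrite -expRD; congr expR; ring.
  rewrite ler_wpM2r ?expR_ge0//; have := expR_ge1Dx (eta * L); move: eL; clear; lra.
have := expR_ge1Dx L; move: h1 L1; clear; lra.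
Qed.

End Sizes.

(** * The uncertainty principle *)

Theorem corollary1p4 (R : realType) :
  exists x0 c : R, 0 < c /\
  forall x : R, x0 <= x ->
  forall (a : nat -> R) (S : {fset nat}) (h : nat -> R),
    (forall n : nat, (0 < n)%N -> 0 <= a n) ->
    (forall p : nat, p \in S -> prime p) ->
    multiplicative_fun h ->
    (forall p : nat, p \in S -> 1 <= (p%:R : R) <= ln (ln x)) ->
    (forall n : nat, (0 < n)%N -> 0 <= h n <= 1) ->
  forall alpha : R,
    60 * ln (ln (ln x)) / ln (ln x) <= alpha ->
    alpha * ln (ln x) <=
      \sum_(1 <= p < (Num.truncn (ln x)).+1 | prime p)
        (1 - h p) / p%:R * ln p%:R ->
  let eta : R := Num.min (alpha / 3) (1 / 100) in
  forall u : R, 5 / eta ^+ 2 <= u <= eta * (ln x `^ (eta / 2)) ->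
  let delta : R :=
    c * expR (- (u / eta * (1 + 25 * eta) * ln (2 * u / eta ^+ 3))) in
  (exists v y : R,
     [/\ `]v, v + y[ `<=` `]x / 4, x[,
         ln x `^ u <= y
       & delta * y * (summatory a x / x) <=
         `|summatory a (v + y) - summatory a v - y * (summatory a x / x)|])
  \/
  (exists (y : R) (q : nat) (b : int),
     [/\ x / 4 < y < x,
         (0 < q)%N,
         coprime_to_all q S,
         q%:R <= expR (2 * (ln x `^ (1 - eta)))
       & delta * (summatory a x / (totient q)%:R) <=
         `|summatory_ap a y q b
           - f_qz h q b / (q%:R * gamma_q h q) * y * (summatory a x / x)|]).
Proof.
(* 528 = 16 * 33 collects the constants of sieve_error_not_small and
   maier_matrix. *)
have [c [c0 c1]] : exists c : R, 0 < c /\ 528 * c < 1.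
  by exists (1 / 600); split; lra.
exists (expR (expR (expR 100))), c; split => // x hx a S h ha hSp [h1 _] hS h01 alpha hal hsum eta u /andP[u1 u2] delta.
have x0 : 0 < x by apply: lt_le_trans hx; exact: expR_gt0.
have lx : expR (expR 100) <= ln x by rewrite -[leLHS]expRK ler_ln ?posrE ?expR_gt0.
have l0 : 0 < ln x by apply: lt_le_trans lx; exact: expR_gt0.
have Lx : expR 100 <= ln (ln x) by rewrite -[leLHS]expRK ler_ln ?posrE ?expR_gt0.
have L0 : 0 < ln (ln x) by apply: lt_le_trans Lx; exact: expR_gt0.
have lnL : 100 <= ln (ln (ln x)) by rewrite -[leLHS]expRK ler_ln ?posrE ?expR_gt0.
set L := ln (ln x) in hS hal hsum Lx L0 lnL.
have lE : ln x = expR L by rewrite lnK ?posrE.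
have xE : x = expR (expR L) by rewrite -lE lnK ?posrE.
have e1 : eta <= 1 / 100 by rewrite /eta ge_min lexx orbT.
have e3 : 3 * eta <= alpha.
  have : eta <= alpha / 3 by rewrite /eta ge_min lexx.
  by clear; lra.
(* So that eta >= 20 ln L / L also when eta = 1/100. *)
have big : 100 * (20 * ln L) <= L.
  rewrite -[leRHS]lnK ?posrE//; set y := ln L in lnL *.
  have y0 : 0 <= y by move: lnL; clear; lra.
  apply: le_trans (expR_quartic y0).
  have : 100 * 100 * 100 * y <= y ^+ 4.
    rewrite (_ : y ^+ 4 = y * y * y * y); last by ring.
    by rewrite ler_wpM2r// ler_pM ?ler0n ?mulr_ge0 ?ler0n// ler_pM ?ler0n.
  by move: y0; clear; lra.
have eL : 20 * ln L <= eta * L.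
  have e20 : 20 * ln L / L <= eta.
    rewrite /eta le_min; apply/andP; split.
      rewrite ler_pdivlMr//; apply: le_trans hal; rewrite le_eqVlt; apply/orP; left; apply/eqP.
      by ring.
    by rewrite ler_pdivrMr//; move: big; clear; lra.
  by rewrite -ler_pdivrMr.
have eL2 : 2000 <= eta * L by move: eL lnL; clear; lra.
have e0 : 0 < eta by rewrite -(pmulr_lgt0 _ L0); move: eL2; clear; lra.
have L100 : 100 <= L by have := expR_ge1Dx (100 : R); move: Lx; clear; lra.
have lnxp z : ln x `^ z = expR (z * L) by rewrite powRE.
rewrite !lnxp in u2 *.
have {}u2 : u <= eta * expR (eta * L / 2) by rewrite (_ : eta * L / 2 = eta / 2 * L)//; ring.
have u0 : 0 < u by apply: lt_le_trans u1; rewrite divr_gt0 ?exprn_gt0.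
have eL100 : 100 <= eta * L by move: eL2; clear; lra.
have [sz1 sz2] := size_bounds e0 e1 eL100 L100 u0 u2.
rewrite -xE in sz1 sz2.
have wt01 p : prime p -> 0 <= 1 - h p <= 1.
  by move=> pp; have /andP[b1 b2] := h01 p (prime_gt0 pp); rewrite subr_ge0 b2 gerBl.
have hwS : 3 * eta * L <= weighted_mertens (fun p => 1 - h p) L.
  rewrite /weighted_mertens -lE; apply: le_trans hsum.
  by rewrite ler_wpM2r// ltW.
have eL600 : 600 <= eta * L by move: eL2; clear; lra.
have [lP [lP1 lP2 hlam]] := exists_dense_window wt01 e0 e1 eL600 hwS.
set W := window _ _ in hlam.
have Wp : all prime W := window_prime _ _.
have Wu : uniq W := window_uniq _ _.
have lP4 : 400 <= lP by move: lP1 eL2; clear; lra.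
have lP0 : 0 < lP by move: lP4; clear; lra.
have hl p : p \in W -> lP <= ln (p%:R : R) <= 21 / 20 * lP.
  by move=> /window_ln/andP[k1 ->]; rewrite ltW.
have lPL : lP <= L.
  have : (1 - eta) * L <= L by rewrite ler_piMl ?(ltW L0)// gerBl ltW.
  by move: lP2 lP0; clear; lra.
have hg p : p \in W -> 0 <= local_defect h p <= 1.
  move=> /(allP Wp) pp; have /andP[b1 ->] := local_defect_bounds h01 pp.
  by rewrite (le_trans _ b1)//; have /andP[] := wt01 p pp.
have inv4 := window_inv_sum_le lP4.
rewrite -/W in inv4.
have lam1 : eta / 250 <= \sum_(p <- W) local_defect h p / p%:R.
  apply: le_trans hlam _; rewrite big_seq [leRHS]big_seq; apply: ler_sum => p /(allP Wp) pp.
  by rewrite ler_wpM2r ?invr_ge0//; have /andP[] := local_defect_bounds h01 pp.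
have lam2 : \sum_(p <- W) local_defect h p / p%:R <= 1.
  apply: le_trans (_ : \sum_(p <- W) (p%:R : R)^-1 <= _); last by move: inv4; clear; lra.
  rewrite big_seq [leRHS]big_seq; apply: ler_sum => p pW.
  by rewrite ler_piMl ?invr_ge0//; have /andP[] := hg p pW.
have lnLQ : 0 <= u / eta * ln (2 * u / eta ^+ 3).
  rewrite mulr_ge0 ?divr_ge0 ?(ltW u0) ?(ltW e0)// ln_ge0//.
  rewrite ler_pdivlMr ?exprn_gt0// mul1r.
  apply: le_trans (_ : 1 <= _).
    by rewrite exprn_ile1 ?(ltW e0)//; move: e1; clear; lra.
  have : 1 <= u.
    apply: le_trans u1; rewrite ler_pdivlMr ?exprn_gt0// mul1r.
    apply: le_trans (_ : 1 <= _); last by rewrite ler1n.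
    by rewrite exprn_ile1 ?(ltW e0)//; move: e1; clear; lra.
  by clear; lra.
have d0 : 0 <= delta by rewrite mulr_ge0 ?expR_ge0// ltW.
have hd : 16 * (33 * delta) * expR (u / eta * ln (2 * u / eta ^+ 3)) < 1.
  apply: le_lt_trans c1; rewrite /delta.
  set y := u / eta * ln _ in lnLQ *.
  rewrite (_ : u / eta * (1 + 25 * eta) * ln _ = y + 25 * eta * y); last by rewrite /y; ring.
  rewrite (_ : 16 * (33 * (c * expR (- (y + 25 * eta * y)))) * expR y =
     528 * c * (expR (- (y + 25 * eta * y)) * expR y)); last by ring.
  rewrite ler_piMr ?mulr_ge0 ?ler0n ?(ltW c0)// -expRD expR_le1.
  have : 0 <= 25 * eta * y by apply: mulr_ge0 lnLQ; rewrite mulr_ge0 ?ler0n ?(ltW e0).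
  by clear; lra.
have d33 : 0 <= 33 * delta by rewrite mulr_ge0 ?ler0n.
have [n [n1 n2 hn]] := sieve_error_large Wp Wu hg hl lP1 lPL e0 e1 eL lnL lam1 lam2 u1 u2 d33 hd.
pose q := (\prod_(p <- W) p)%N.
have q0 : (0 < q)%N := prod_primes_gt0 Wp.
have qle : q%:R <= expR (2 * expR ((1 - eta) * L)).
  apply: le_trans (window_prod_le _) _; first by move: lP4; clear; lra.
  by rewrite ler_expR ler_wpM2l// ler_expR.
have qS : coprime_to_all q S.
  move=> p pS; rewrite dvd_prod_primes ?hSp//; apply/negP => pW.
  have /andP[_ pL] := hS p pS.
  have /andP[k1 _] := hl p pW.
  have : ln (p%:R : R) <= ln L by rewrite ler_ln ?posrE// ltr0n prime_gt0// hSp.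
  by move: k1 lP1 eL lnL; clear; lra.
set rho := summatory a x / x.
have A0 : 0 <= summatory a x.
  rewrite /summatory big_nat_cond; apply: sumr_ge0 => k /andP[/andP[k0 _] _]; exact: ha.
have nx : 4 * n%:R <= x by move: n2 sz1; clear; lra.
have qx : 16 * q%:R <= x by move: qle sz2; clear; lra.
have uLx : expR (u * L) <= x / 8.
  apply: le_trans (_ : expR (7 / 4 * (u * L)) <= _); last by move: sz1; clear; lra.
  by rewrite ler_expR; have := mulr_gt0 u0 L0; clear; lra.
(* When A(x) = 0 any interval of the right length satisfies (i). *)
have [rz|rnz] := eqVneq rho 0.
  left; exists (x / 4), (expR (u * L)); split => //.
    move=> z; rewrite /= !in_itv/= => /andP[-> hz] /=.
    by apply: lt_trans hz _; move: uLx x0; clear; lra.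
  by rewrite rz mulr0.
have rho0 : 0 < rho by rewrite lt_def rnz divr_ge0// ltW.
apply: contrapT => /not_orP[hA hB].
have n0 : (0 < n)%N by rewrite -(ltr0n R); apply: lt_le_trans n1; exact: expR_gt0.
have gm0 : 0 < gamma_q h q.
  rewrite gamma_qE// /sieve_mean big_seq; elim/big_ind: _ => // [y z|p pW]; first exact: mulr_gt0.
  have /andP[_ g1] := hg p pW.
  have p2 : (1 : R) < p%:R by rewrite ltr1n prime_gt1// (allP Wp).
  rewrite subr_gt0 ltr_pdivrMr ?mul1r; first exact: le_lt_trans p2.
  by apply: lt_trans p2.
have hrow (v : nat) : x / 4 < v%:R -> v%:R + n%:R < x ->
   `|summatory a (v%:R + n%:R) - summatory a v%:R - n%:R * rho| <= delta * n%:R * rho.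
  move=> v1 v2; rewrite leNgt; apply/negP => hv; apply: hA; exists v%:R, n%:R; split => //.
    move=> z; rewrite /= !in_itv/= => /andP[z1 z2].
    by rewrite (lt_trans v1 z1) (lt_trans z2 v2).
  exact: ltW.
have hcol (y s : nat) : x / 4 < y%:R -> y%:R < x -> (0 < s)%N ->
   `|summatory_ap a y%:R q s%:Z - f_qz h q s%:Z / (q%:R * gamma_q h q) * y%:R * rho| <=
     delta * (rho * x / (totient q)%:R).
  move=> y1 y2 s0; rewrite leNgt; apply/negP => hy; apply: hB.
  exists y%:R, q, s%:Z; split => //; first by rewrite y1.
  by apply: ltW; move: hy; rewrite /rho divfK ?gt_eqF.
have := maier_matrix q0 n0 x0 rho0 d0 gm0 qx nx hrow hcol.
rewrite -sieve_errorE// leNgt => /negP; apply; apply: le_lt_trans hn.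
rewrite ler_wpM2r//.
have gm1 : gamma_q h q <= 1.
  by rewrite gamma_qE//; have /andP[] := sieve_mean01 Wp hg.
have qphi : q%:R / (totient q)%:R <= 2 :> R.
  apply: le_trans (totient_ratio R Wp Wu) _.
  have h5 := expR_ge1Dx (- (1 / 2) : R).
  apply: le_trans (_ : expR (1 / 2) <= _).
    by rewrite ler_expR; move: inv4; clear; lra.
  have e5 := expR_gt0 (1 / 2 : R); rewrite expRN in h5.
  by have := ler_wpM2l (ltW e5) h5; rewrite mulfV ?gt_eqF//; clear; lra.
have k33 : 1 + 16 * (q%:R / (totient q)%:R) <= 33 :> R by move: qphi; clear; lra.
apply: le_trans (_ : 1 * (delta * (1 + 16 * (q%:R / (totient q)%:R))) <= _).
  rewrite ler_wpM2r// mulr_ge0// addr_ge0// mulr_ge0 ?ler0n// divr_ge0//.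
by rewrite mul1r mulrC ler_wpM2r.
Qed.
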